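(* Let $\pi$ be a sorted permutation with $k$ descents, and let $\mathcal B^\pi$ and $\mathbf y^\pi=(y_I^\pi)_{I\in\mathcal B^\pi}$ be the binary building set on $[k+1]$ and the tuple of positive integers constructed from the canonical hook configuration of $\pi$ as described in the context. Then the fertilitope of $\pi$ satisfies \[\mathrm{Fer}_\pi=\sum_{I\in\mathcal B^\pi}y_I^\pi\,\Delta_I,\] where the sum is a Minkowski sum.
   Context: A permutation of size $n\ge 1$ is an ordering $\pi=\pi_1\cdots\pi_n$ of a set of $n$ distinct positive integers. A descent of $\pi$ is an index $i\in[n-1]$ with $\pi_i>\pi_{i+1}$. The plot of $\pi$ is the set of points $(i,\pi_i)$, $i\in[n]$. A hook of $\pi$ with southwest endpoint $(i,\pi_i)$ and northeast endpoint $(j,\pi_j)$, where $i<j$ and $\pi_i<\pi_j$, is the union of the vertical segment from $(i,\pi_i)$ to $(i,\pi_j)$ and the horizontal segment from $(i,\pi_j)$ to $(j,\pi_j)$. A point $(m,\pi_m)$ lies directly above (respectively, below) this hook if $i<m<j$ and $\pi_m>\pi_j$ (respectively, $\pi_m<\pi_j$). It lies weakly below the hook if it lies below it or is its northeast endpoint. Let $d_1<\cdots<d_k$ be the descents of $\pi$. A valid hook configuration of $\pi$ is a tuple $\mathcal H=(H_1,\ldots,H_k)$ of hooks of $\pi$ such that: (1) $H_i$ has southwest endpoint $(d_i,\pi_{d_i})$ for each $i$; (2) no point of the plot lies directly above a hook of $\mathcal H$; (3) no two hooks of $\mathcal H$ intersect or overlap, except that the northeast endpoint of one may be the southwest endpoint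 of another. (If $k=0$, there is exactly one, the empty configuration.) Let $\mathrm{VHC}(\pi)$ be the set of valid hook configurations of $\pi$. Each $\mathcal H\in\mathrm{VHC}(\pi)$ induces a coloring of the $n-k$ points of the plot that are not northeast endpoints of hooks of $\mathcal H$: such a point $(m,\pi_m)$ gets the color of the lowest hook of $\mathcal H$ lying above it (i.e. among the hooks of $\mathcal H$ below which it lies, the one whose northeast endpoint has smallest height; a hook is not considered to lie above its own southwest endpoint), and the color of the ''sky'' if there is no such hook. Let $q_i$ be the number of points with the color of $H_i$ ($1\le i\le k$) and $q_0$ the number with the color of the sky. Then $\mathbf q^{\mathcal H}=(q_0,\ldots,q_k)$ is a composition of $n-k$ into $k+1$ (positive) parts. Set $\mathcal V(\pi)=\{\mathbf q^{\mathcal H}:\mathcal H\in\mathrm{VHC}(\pi)\}$ and $\mathrm{Fer}_\pi=\mathrm{conv}(\mathcal V(\pi))\subseteq\mathbb R^{k+1}$ (the fertilitope of $\pi$). The stack-sorting map $s$ fixes the empty word and satisfies $s(LmR)=s(L)s(R)m$, where $m$ is the largest entry of $LmR$. A permutation is sorted if it is in the image of $s$; it is known that $\pi$ is sorted if and only if $\mathcal V(\pi)\neq\emptyset$. The canonical hook configuration $\mathcal H^*=(H_1^*,\ldots,H_k^* )$ of $\pi$, which exists when $\mathrm{VHC}(\pi)\ne\emptyset$, is constructed in the order $H_k^*,\ldots,H_1^*$: $H_\ell^*$ is the hook with southwest endpoint $(d_\ell,\pi_{d_\ell})$ whose northeast endpoint is the lowest point of the plot that is above and to the right of $(d_\ell,\pi_{d_\ell})$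 and does not lie weakly below any of $H_k^*,\ldots,H_{\ell+1}^*$. A binary plane tree is a rooted tree in which each vertex has at most two children and each child is designated as a left or right child (possibly a vertex has only one child, left or right). It is full if each vertex has $0$ or $2$ children. Given $\mathcal H\in\mathrm{VHC}(\pi)$, let $\Theta(\mathcal H)$ be the binary plane tree with vertices labeled by the entries of $\pi$ (root $\pi_n$) in which, for each $i\in[n-1]$: if $i$ is a descent of $\pi$, then $\pi_i$ is the left child of $\pi_j$, where $(j,\pi_j)$ is the northeast endpoint of the hook of $\mathcal H$ with southwest endpoint $(i,\pi_i)$; otherwise $\pi_i$ is the right child of $\pi_{i+1}$. Construction of $\mathcal B^\pi,\mathbf y^\pi$: let $T^\pi$ be $\Theta(\mathcal H^* )$ with its labels removed. Assign each leaf the new label $1$ and each internal vertex the new label $0$. Repeatedly: whenever a vertex $v$ has no left child and has a right child $u$ that is either a leaf or has two children, contract the edge $uv$ to a single vertex, identified with $u$, and increase the label of $u$ by $1$. Stop when the tree is full; call it $\widehat T^\pi$ (it does not depend on the choices made, and has $k+1$ leaves). Identify the leaves of $\widehat T^\pi$ with $\{1\},\ldots,\{k+1\}$ from left to right and each internal vertex with the union of the leaves below it. For each vertex $I$ let $y_I^\pi$ be its label; $\mathcal B^\pi$ is the set of vertices $I$ with $y_I^\pi>0$. For $I\subseteq[k+1]$, $\Delta_I=\mathrm{conv}(\{e_i:i\in I\})\subseteq\mathbb R^{k+1}$, with $e_1,\ldots,e_{k+1}$ the standard basis. *)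

(* Defs.v *)
From HB Require Import structures.
From Stdlib Require Import Relations.
From mathcomp Require Import all_boot all_order all_algebra.
From mathcomp Require Import boolp classical_sets reals convex.

Set Implicit Arguments.
Unset Strict Implicit.
Unset Printing Implicit Defensive.

Import Order.TTheory GRing.Theory Num.Theory.

(** * Permutations and stack-sorting

    Permutations are words; positions are 0-based, so that [entry p i] is the
    entry written pi_(i+1) on paper and plots are translated one unit left. *)

Definition is_perm (p : seq nat) : bool :=
  [&& 0 < size p, uniq p & all (fun x => 0 < x) p].

Notation entry p i := (nth 0%N p i).

Definition descents (p : seq nat) : seq nat :=
  [seq i <- iota 0 (size p).-1 | entry p i.+1 < entry p i].

Definition ndes (p : seq nat) : nat := size (descents p).

(* The recursion equation of the stack-sorting map is [stack_sort_cat]. *)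
Fixpoint stack_sort_rec (fuel : nat) (w : seq nat) : seq nat :=
  match fuel, w with
  | fuel'.+1, _ :: _ =>
      let m := \max_(x <- w) x in
      stack_sort_rec fuel' (take (index m w) w) ++
      stack_sort_rec fuel' (drop (index m w).+1 w) ++ [:: m]
  | _, _ => [::]
  end.

Definition stack_sort (w : seq nat) : seq nat := stack_sort_rec (size w) w.

Definition sorted_perm (p : seq nat) : Prop :=
  is_perm p /\ exists2 w, is_perm w & stack_sort w = p.

Lemma stack_sort_nil : stack_sort [::] = [::].
Proof. by []. Qed.

Lemma bigmax_seq_mem (x : nat) (w : seq nat) :
  \max_(y <- x :: w) y \in x :: w.
Proof.
elim: w x => [|z w IH] x; first by rewrite big_seq1 mem_head.
rewrite big_cons inE; case: leqP => _; last by rewrite eqxx.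
by rewrite IH orbT.
Qed.

Lemma stack_sort_rec_fuel (m n : nat) (w : seq nat) :
  size w <= m -> size w <= n -> stack_sort_rec m w = stack_sort_rec n w.
Proof.
elim: m n w => [|m IH] [|n] [|x w] // lem len.
rewrite /stack_sort_rec -/stack_sort_rec.
set M := \max_(_ <- _) _; have := bigmax_seq_mem x w; rewrite -index_mem -/M.
set i := index _ _ => lti.
have szL : size (take i (x :: w)) <= size w by rewrite size_take lti -ltnS.
have szR : size (drop i.+1 (x :: w)) <= size w
  by rewrite size_drop /= subSS leq_subr.
by congr (_ ++ (_ ++ _)); apply: IH; apply: leq_trans; by [exact: szL | exact: szR | rewrite -ltnS].
Qed.

Lemma stack_sort_cat (L R : seq nat) (m : nat) :
  all (fun x => x < m) (L ++ R) ->
  stack_sort (L ++ m :: R) = stack_sort L ++ stack_sort R ++ [:: m].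
Proof.
rewrite all_cat => /andP[/allP ltL /allP ltR].
have maxm : \max_(x <- L ++ m :: R) x = m.
  rewrite big_cat big_cons /= maxnCA; apply/maxn_idPl.
  rewrite geq_max; apply/andP; split; apply/bigmax_leqP_seq => x xin _;
    apply: ltnW; by [exact: ltL | exact: ltR].
have mL : m \notin L by apply/negP => /ltL; rewrite ltnn.
have im : index m (L ++ m :: R) = size L.
  by rewrite index_cat (negPf mL) /= eqxx addn0.
have -> : stack_sort (L ++ m :: R)
    = stack_sort_rec (size L + size R).+1 (L ++ m :: R).
  by rewrite /stack_sort size_cat /= addnS.
have -> : stack_sort_rec (size L + size R).+1 (L ++ m :: R) =
    let M := \max_(x <- L ++ m :: R) x in
    stack_sort_rec (size L + size R) (take (index M (L ++ m :: R)) (L ++ m :: R)) ++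
    stack_sort_rec (size L + size R) (drop (index M (L ++ m :: R)).+1 (L ++ m :: R))
    ++ [:: M].
  by case: (L).
have dR : drop (size L).+1 (L ++ m :: R) = R.
  by rewrite -cat_rcons drop_size_cat ?size_rcons.
rewrite maxm /= im dR take_size_cat //.
rewrite /stack_sort (@stack_sort_rec_fuel _ (size L) L) ?leq_addr //.
by rewrite (@stack_sort_rec_fuel _ (size R) R) ?leq_addl.
Qed.

(** * Hooks and valid hook configurations

    A hook is represented by the positions of its endpoints: [h.1] for the
    southwest one, [h.2] for the northeast one. *)

Definition hook : Type := (nat * nat)%type.

Definition is_hook (p : seq nat) (h : hook) : bool :=
  [&& h.1 < h.2, h.2 < size p & entry p h.1 < entry p h.2].

Definition directly_above (p : seq nat) (m : nat) (h : hook) : bool :=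
  (h.1 < m < h.2) && (entry p h.2 < entry p m).

Definition below (p : seq nat) (m : nat) (h : hook) : bool :=
  (h.1 < m < h.2) && (entry p m < entry p h.2).

Definition weakly_below (p : seq nat) (m : nat) (h : hook) : bool :=
  below p m h || (m == h.2).

Section Plane.
Variable R : realType.
Local Open Scope classical_set_scope.
Local Open Scope ring_scope.

Definition plot_point (p : seq nat) (i : nat) : R * R :=
  (i%:R, (entry p i)%:R).

Definition hook_curve (p : seq nat) (h : hook) : set (R * R) :=
  [set z | z.1 = (h.1)%:R /\ (entry p h.1)%:R <= z.2 <= (entry p h.2)%:R] `|`
  [set z | z.2 = (entry p h.2)%:R /\ (h.1)%:R <= z.1 <= (h.2)%:R].

(* The equation on southwest endpoints makes the i-th hook start at the i-th
   descent; in particular a configuration has exactly [ndes p] hooks, which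
   are pairwise distinct. *)
Definition VHC (p : seq nat) : set (seq hook) :=
  [set H | [/\ all (is_hook p) H,
               [seq h.1 | h <- H] = descents p,
               forall h m, h \in H -> ~~ directly_above p m h &
               forall g h z, g \in H -> h \in H -> g <> h ->
                 hook_curve p g z -> hook_curve p h z ->
                 (z = plot_point p g.2 /\ z = plot_point p h.1) \/
                 (z = plot_point p h.2 /\ z = plot_point p g.1)]].

End Plane.

(** * Colorings *)

(* Color 0 is the sky and color c > 0 is that of the c-th hook H_c. *)
Definition has_color (p : seq nat) (H : seq hook) (m c : nat) : bool :=
  if c is i.+1 then
    let h := nth (0, 0) H i in
    [&& i < size H, below p m h &
        all (fun g => below p m g ==> (entry p h.2 <= entry p g.2)) H]
  else ~~ has (below p m) H.

Definition color_count (p : seq nat) (H : seq hook) (c : nat) : nat :=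
  count (fun m => (m \notin [seq h.2 | h <- H]) && has_color p H m c)
        (iota 0 (size p)).

(** * Convex hulls, fertilitopes and Minkowski sums *)

Section Polytopes.
Local Open Scope classical_set_scope.
Local Open Scope ring_scope.

Definition conv (R : realType) (n : nat) (A : set 'rV[R]_n) : set 'rV[R]_n :=
  smallest (@convex_set R 'rV[R]_n) A.

Definition qvec (R : realType) (p : seq nat) (H : seq hook) :
    'rV[R]_(ndes p).+1 :=
  \row_c (color_count p H c)%:R.

Definition Vset (R : realType) (p : seq nat) : set 'rV[R]_(ndes p).+1 :=
  @qvec R p @` VHC R p.

Definition Fer (R : realType) (p : seq nat) : set 'rV[R]_(ndes p).+1 :=
  conv (@Vset R p).

Definition Delta (R : realType) (n : nat) (I : {set 'I_n}) : set 'rV[R]_n :=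
  conv [set e | exists2 i, i \in I & e = delta_mx 0 i].

Definition dilate (R : realType) (n : nat) (a : R) (A : set 'rV[R]_n) :
    set 'rV[R]_n :=
  [set a *: x | x in A].

Definition msum (R : realType) (n : nat) (A B : set 'rV[R]_n) :
    set 'rV[R]_n :=
  [set x + y | x in A & y in B].

Section MsumLaw.
Variables (R : realType) (n : nat).

Lemma msumA : associative (@msum R n).
Proof.
move=> A B C; apply/seteqP; split => z.
  case=> x Ax [_ [y By [w Cw <-] <-]]; exists (x + y); first by exists x => //; exists y.
  by exists w => //; rewrite addrA.
case=> _ [x Ax [y By <-]] [w Cw <-]; exists x => //.
by exists (y + w); [exists y => //; exists w | rewrite addrA].
Qed.

Lemma msumC : commutative (@msum R n).
Proof.
by move=> A B; apply/seteqP; split => z [x Ax [y By <-]];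
   exists y => //; exists x => //; rewrite addrC.
Qed.

Lemma msum0s : left_id [set (0 : 'rV[R]_n)] (@msum R n).
Proof.
move=> A; apply/seteqP; split => z; first by case=> _ -> [y Ay <-]; rewrite add0r.
by move=> Az; exists 0 => //; exists z => //; rewrite add0r.
Qed.

HB.instance Definition _ :=
  Monoid.isComLaw.Build (set 'rV[R]_n) [set (0 : 'rV[R]_n)] (@msum R n)
    msumA msumC msum0s.

End MsumLaw.

End Polytopes.

Arguments Vset : clear implicits.
Arguments Fer : clear implicits.
Arguments Delta R {n} I.

(** * Canonical hook configurations

    [Hs] are the hooks already constructed, those of the later descents.  When
    there is no candidate (which does not happen if [VHC p] is nonempty), the
    northeast endpoint is the junk value 0. *)

Definition canonical_ne (p : seq nat) (d : nat) (Hs : seq hook) : nat :=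
  let candidates := [seq j <- iota 0 (size p) |
    [&& d < j, entry p d < entry p j & all (fun h => ~~ weakly_below p j h) Hs]]
  in head 0 (sort (fun i j => entry p i <= entry p j) candidates).

Definition canonical (p : seq nat) : seq hook :=
  foldr (fun d Hs => (d, canonical_ne p d Hs) :: Hs) [::] (descents p).

(** * Binary plane trees

    [Empty] stands for a missing child: a binary plane tree is a [btree] other
    than [Empty]. *)

Inductive btree : Type :=
  | Empty
  | Node (l : btree) (a : nat) (r : btree).

Definition is_empty (t : btree) : bool := if t is Empty then true else false.

(* [Theta_at p H fuel j] is the subtree rooted at the vertex of position j: its
   left child is the southwest endpoint of the hook ending at j, if any, and
   its right child is position j - 1, unless this is a descent.  Positions
   decrease away from the root, so fuel j + 1 suffices. *)
Fixpoint Theta_at (p : seq nat) (H : seq hook) (fuel j : nat) : btree :=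
  if fuel is fuel'.+1 then
    Node
      (if [seq h <- H | h.2 == j] is h :: _ then Theta_at p H fuel' h.1
       else Empty)
      (entry p j)
      (if j is i.+1 then
         if i \in descents p then Empty else Theta_at p H fuel' i
       else Empty)
  else Empty.

Definition Theta (p : seq nat) (H : seq hook) : btree :=
  Theta_at p H (size p) (size p).-1.

Fixpoint init_labels (t : btree) : btree :=
  if t is Node l _ r then
    Node (init_labels l) (if is_empty l && is_empty r then 1 else 0) (init_labels r)
  else Empty.

(** * Contraction *)

(* The contracted edge joins a vertex v without left child to its right child
   [Node l a r], which must have 0 or 2 children; the label of v is dropped. *)
Inductive contract1 : btree -> btree -> Prop :=
  | contract_root b l a r : is_empty l = is_empty r ->
      contract1 (Node Empty b (Node l a r)) (Node l a.+1 r)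
  | contract_left l l' a r : contract1 l l' ->
      contract1 (Node l a r) (Node l' a r)
  | contract_right l a r r' : contract1 r r' ->
      contract1 (Node l a r) (Node l a r').

Definition contracts : btree -> btree -> Prop := clos_refl_trans btree contract1.

Fixpoint full (t : btree) : bool :=
  if t is Node l _ r then [&& is_empty l == is_empty r, full l & full r]
  else true.

(* The end result of the contractions, performed bottom-up; [contracts_hat],
   [full_hat] and [hat_unique] show that this is the procedure described by
   [contract1], and that its outcome does not depend on the choices made. *)
Fixpoint hat (t : btree) : btree :=
  if t is Node l a r then
    match hat l, hat r with
    | Empty, Node rl b rr =>
        if is_empty rl == is_empty rr then Node rl b.+1 rr
        else Node Empty a (Node rl b rr)
    | l', r' => Node l' a r'
    end
  else Empty.

Lemma is_empty_hat (t : btree) : is_empty (hat t) = is_empty t.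
Proof.
by case: t => //= l a r; case: (hat l) => // ; case: (hat r) => // *; case: ifP.
Qed.

Lemma contracts_Node (l l' r r' : btree) (a : nat) :
  contracts l l' -> contracts r r' -> contracts (Node l a r) (Node l' a r').
Proof.
move=> cl cr; apply: (rt_trans _ _ _ (Node l' a r)).
  elim: cl => [x y xy|x|x y z _ xy _ yz]; last exact: rt_trans xy yz.
    by apply: rt_step; apply: contract_left.
  exact: rt_refl.
elim: cr => [x y xy|x|x y z _ xy _ yz]; last exact: rt_trans xy yz.
  by apply: rt_step; apply: contract_right.
exact: rt_refl.
Qed.

Lemma contracts_hat (t : btree) : contracts t (hat t).
Proof.
elim: t => [|l IHl a r IHr] /=; first exact: rt_refl.
have c := contracts_Node a IHl IHr.
case: (hat l) c => [|? ? ?] //; case: (hat r) => [|rl b rr] //.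
case: eqP => // e c; apply: rt_trans c _.
by apply: rt_step; apply: contract_root.
Qed.

(* Holds for [Theta p H] when [H] is a valid hook configuration. *)
Fixpoint left_implies_right (t : btree) : bool :=
  if t is Node l _ r then
    [&& is_empty r ==> is_empty l, left_implies_right l & left_implies_right r]
  else true.

Lemma full_hat (t : btree) : left_implies_right t -> full (hat t).
Proof.
elim: t => //= l IHl a r IHr /and3P[elr /IHl fl /IHr fr].
move: elr fl fr; rewrite -(is_empty_hat l) -(is_empty_hat r).
case: (hat l) => [|? ? ?]; case: (hat r) => [|? ? ?] //=.
  by move=> _ _ /and3P[e f1 f2]; rewrite e /= e f1 f2.
by move=> _ -> ->.
Qed.

Lemma hat_full_id (t : btree) : full t -> hat t = t.
Proof.
elim: t => //= l IHl a r IHr /and3P[e /IHl -> /IHr ->].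
by case: l e {IHl} => [|? ? ?] //; case: r {IHr}.
Qed.

Lemma hat_contract1 (t t' : btree) : contract1 t t' -> hat t = hat t'.
Proof.
elim=> [b l a r e|l l' a r _ /= -> //|l a r r' _ /= -> //].
move: e; rewrite /= -(is_empty_hat l) -(is_empty_hat r).
by case: (hat l) => [|? ? ?]; case: (hat r) => [|? ? ?].
Qed.

Lemma hat_unique (t t' : btree) : contracts t t' -> full t' -> t' = hat t.
Proof.
move=> c f; rewrite -(hat_full_id f); elim: c {f} => //.
  by move=> x y /hat_contract1.
by move=> x y z _ xy _ yz; rewrite yz.
Qed.

(** * The building set and its labels *)

Fixpoint nleaves (t : btree) : nat :=
  match t with
  | Empty => 0
  | Node Empty _ Empty => 1
  | Node l _ r => nleaves l + nleaves r
  end.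

(* In both functions, [o] is the number of leaves to the left of [t]. *)
Fixpoint leafset (m : nat) (o : nat) (t : btree) : {set 'I_m} :=
  match t with
  | Empty => finset.set0
  | Node Empty _ Empty => [set i : 'I_m | i == o :> nat]
  | Node l _ r => leafset m o l :|: leafset m (o + nleaves l) r
  end.

Fixpoint vertices (m : nat) (o : nat) (t : btree) : seq ({set 'I_m} * nat) :=
  if t is Node l a r then
    (leafset m o t, a) :: vertices m o l ++ vertices m (o + nleaves l) r
  else [::].

Definition That (p : seq nat) : btree := hat (init_labels (Theta p (canonical p))).

(* Vertices of a full tree are determined by the leaves below them, so at most
   one label is listed for each [I]. *)
Definition ylabel (p : seq nat) (I : {set 'I_(ndes p).+1}) : nat :=
  head 0 [seq v.2 | v <- vertices (ndes p).+1 0 (That p) & v.1 == I].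

Definition building_set (p : seq nat) : {set {set 'I_(ndes p).+1}} :=
  [set I | 0 < ylabel I].

(* Main.v *)
From mathcomp Require Import all_boot all_order all_algebra zify.
From mathcomp Require Import interval_inference boolp classical_sets reals
  convex.
Require Import Defs.

Set Implicit Arguments.
Unset Strict Implicit.
Unset Printing Implicit Defensive.

(** Reading the plot from left to right, an open hook is closed at its northeast
    endpoint, so a valid hook configuration is a way of deciding, at each
    position, whether to close the hook on top of the stack of open hooks; a
    position at which none is closed is colored by the top of the stack.  The
    canonical configuration closes hooks as early as possible, and its tree
    [t] predicts all color vectors: the vectors [q] are exactly the sums
    obtained by letting each vertex of [t] without left child choose a leaf
    below it.  For "only such sums", a scan of a subtree that leaves [r] hooks
    open has produced [r] colors too many, all of them leaves of the subtree;
    this is proved by induction on [t].  For "all such sums", appending a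
    position at which the entry is a new maximum allows any color to be added,
    by delaying the closing of hooks.  Contracting [t] collects the vertices
    with the same set of leaves, and convex hulls commute with Minkowski sums.
      *)

Import Order.TTheory GRing.Theory Num.Theory.

(** * Convex hulls and Minkowski sums *)

Section MinkowskiSums.
Local Open Scope classical_set_scope.
Local Open Scope ring_scope.
Variables (R : realType) (n : nat).
Implicit Types A B C : set 'rV[R]_n.

Lemma convex_setP A :
  @convex_set R 'rV[R]_n A <->
  forall (x y : 'rV[R]_n) (k : R), 0 <= k -> k <= 1 -> A x -> A y ->
    A (k *: x + (1 - k) *: y).
Proof.
split=> [cA x y k k0 k1 Ax Ay|cA x y k /set_mem Ax /set_mem Ay].
  have k01 : Itv.spec (@Itv.num_sem R) (Itv.Real `[0%Z, 1%Z]) k.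
    by rewrite /= /Itv.num_sem /= in_itv /= k0 k1 (ger0_real k0).
  by have /set_mem := cA x y (Itv.mk k01) (mem_set Ax) (mem_set Ay).
by apply/mem_set; apply: (cA x y (k%:num)).
Qed.

Lemma conv_convex A : @convex_set R 'rV[R]_n (conv A).
Proof.
apply/convex_setP => x y k k0 k1 cx cy B [/[dup] cB /convex_setP cB' AB].
by apply: cB' => //; [apply: cx | apply: cy].
Qed.

Lemma sub_conv A : A `<=` conv A.
Proof. exact: sub_smallest. Qed.

Lemma conv_sub A B : @convex_set R 'rV[R]_n B -> A `<=` B -> conv A `<=` B.
Proof. by move=> cB AB; apply: smallest_sub. Qed.

Lemma convex_msum A B : @convex_set R 'rV[R]_n A -> @convex_set R 'rV[R]_n B ->
  @convex_set R 'rV[R]_n (msum A B).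
Proof.
move=> /convex_setP cA /convex_setP cB; apply/convex_setP.
move=> _ _ k k0 k1 [x Ax [y By <-]] [z Az [w Bw <-]].
exists (k *: x + (1 - k) *: z); first exact: cA.
exists (k *: y + (1 - k) *: w); first exact: cB.
by rewrite !scalerDr addrACA.
Qed.

Lemma convex_translate A (b : 'rV[R]_n) : @convex_set R 'rV[R]_n A ->
  @convex_set R 'rV[R]_n [set x | A (x + b)].
Proof.
move=> /convex_setP cA; apply/convex_setP => x y k k0 k1 /= Ax Ay.
have -> : k *: x + (1 - k) *: y + b = k *: (x + b) + (1 - k) *: (y + b).
  by rewrite !scalerDr addrACA -scalerDl [k + _]addrC subrK scale1r.
exact: cA.
Qed.

(** For fixed [y] in [B], the [x] with [x + y] in the hull form a convex set containing [A], hence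
    [conv A]; the same argument then runs over [B] with [x] fixed in [conv A]. *)
Lemma conv_msum A B : conv (msum A B) = msum (conv A) (conv B).
Proof.
apply/seteqP; split.
  apply: conv_sub; first by apply: convex_msum; exact: conv_convex.
  by move=> _ [x Ax [y By <-]]; exists x; [|exists y]; try exact: sub_conv.
have step1 y : B y -> conv A `<=` [set x | conv (msum A B) (x + y)].
  move=> By; apply: conv_sub; first exact/convex_translate/conv_convex.
  by move=> x Ax /=; apply: sub_conv; exists x => //; exists y.
move=> _ [x cAx [y cBy <-]]; rewrite addrC.
have : conv B `<=` [set z | conv (msum A B) (z + x)]; last exact.
apply: conv_sub; first exact/convex_translate/conv_convex.
by move=> z Bz /=; rewrite addrC; apply: step1.
Qed.

Lemma dilate0 A : A !=set0 -> dilate 0 A = [set 0].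
Proof.
move=> [a Aa]; apply/seteqP; split => [_ [x _ <-]|_ ->];
  first by rewrite /= scale0r.
by exists a => //; rewrite scale0r.
Qed.

Lemma dilate_succ (m : nat) A : @convex_set R 'rV[R]_n A ->
  dilate m.+1%:R A = msum (dilate m%:R A) A.
Proof.
move=> /convex_setP cA; apply/seteqP; split => [_ [x Ax <-]|].
  exists (m%:R *: x); first by exists x.
  by exists x => //; rewrite -[m.+1]addn1 natrD scalerDl scale1r.
move=> _ [_ [x Ax <-] [y Ay <-]].
have m1 : m.+1%:R != 0 :> R by rewrite pnatr_eq0.
(* With the weights [m / (m + 1)] and [1 / (m + 1)], dilating by [m.+1] gives back [m *: x + y]. *)
exists ((m%:R / m.+1%:R) *: x + (1 - m%:R / m.+1%:R) *: y).
  apply: cA => //.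
  by rewrite ler_pdivrMr ?ltr0n // mul1r ler_nat.
rewrite scalerDr !scalerA mulrBr mulr1 mulrC divfK //.
by rewrite -[m.+1]addn1 natrD addrAC subrr add0r scale1r.
Qed.

Lemma Delta_neq0 (I : {set 'I_n}) : I != finset.set0 -> Delta R I !=set0.
Proof.
by case/set0Pn => i Ii; exists (delta_mx 0 i); apply: sub_conv; exists i.
Qed.

End MinkowskiSums.

(** * Trees of canonical hook configurations *)

(* A subtree occupies an interval of positions, read in postorder, so only the
   positions of the leaves are stored: the root comes right after the root of
   its right subtree. *)
Inductive ptree : Type :=
  | PLeaf (a : nat)
  | POne (t : ptree)
  | PTwo (l r : ptree).

Fixpoint first (t : ptree) : nat :=
  match t with PLeaf a => a | POne t => first t | PTwo l _ => first l end.

Fixpoint root (t : ptree) : nat :=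
  match t with PLeaf a => a | POne t => (root t).+1 | PTwo _ r =>
    (root r).+1 end.

Fixpoint leaves (t : ptree) : seq nat :=
  match t with
  | PLeaf a => [:: a] | POne t => leaves t | PTwo l r => leaves l ++ leaves r
  end.

Section CanonicalTrees.
Variable p : seq nat.

(* The entry of the highest vertex, on the leftmost path, that is not a
   northeast endpoint: the largest entry of [t] left free to close a hook
   opened before [t]. *)
Fixpoint spine (t : ptree) : nat :=
  match t with
  | PLeaf a => entry p a | POne t => entry p (root t).+1 | PTwo l _ => spine l
  end.

(* [spine r < entry p (root l)] says that the hook from [root l] could not have
   been closed earlier. *)
Fixpoint canonical_tree (t : ptree) : bool :=
  match t with
  | PLeaf _ => true
  | POne t => canonical_tree t && (entry p (root t) < entry p (root t).+1)
  | PTwo l r =>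
      [&& canonical_tree l, canonical_tree r, first r == (root l).+1,
          spine r < entry p (root l), entry p (root l) < entry p (root r).+1
        & entry p (root r) < entry p (root r).+1]
  end.

Lemma first_root (t : ptree) : canonical_tree t -> first t <= root t.
Proof.
elim: t => //= [t IH /andP[/IH/leqW] //|l IHl r IHr].
case/and5P => /IHl fl /IHr; move=> fr /eqP e _ _.
by rewrite e in fr; apply: leq_trans fl (leqW (ltnW fr)).
Qed.

Lemma root_max (t : ptree) (i : nat) : canonical_tree t ->
  first t <= i <= root t -> entry p i <= entry p (root t).
Proof.
elim: t => /= [a _|t IH /andP[wt lt]|l IHl r IHr].
- by rewrite -eqn_leq => /eqP ->.
- rewrite [i <= _]leq_eqVlt andb_orr => /orP[/andP[_ /eqP ->] //|/(IH wt) le].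
  exact: leq_trans le (ltnW lt).
case/and5P => wl wr /eqP e _ /andP[ltl ltr].
rewrite [i <= _]leq_eqVlt andb_orr => /orP[/andP[_ /eqP ->] //|/andP[fi ir]].
case: (leqP i (root l)) => il.
  by apply: leq_trans (IHl wl _) (ltnW ltl); rewrite fi.
by apply: leq_trans (IHr wr _) (ltnW ltr); rewrite e il.
Qed.

Lemma spine_entry (t : ptree) : canonical_tree t ->
  exists2 i, first t <= i <= root t & spine t = entry p i.
Proof.
elim: t => /= [a _|t IH /andP[wt _]|l IHl r IHr].
- by exists a => //; rewrite leqnn.
- by exists (root t).+1 => //; rewrite leqnn andbT leqW // first_root.
case/and5P => /IHl [i /andP[fi il] ->] wr /eqP e _ _; exists i => //.
rewrite fi leqW // (leq_trans il) // ltnW // -e.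
exact: first_root wr.
Qed.

Lemma spine_root (t : ptree) : canonical_tree t -> spine t <= entry p (root t).
Proof. by move=> wt; have [i it ->] := spine_entry wt; apply: root_max. Qed.

Lemma first_spine (t : ptree) : canonical_tree t ->
  entry p (first t) <= spine t.
Proof.
elim: t => //= [t IH /andP[wt /ltnW lt]|l IHl r IHr].
  by apply: leq_trans lt; apply: root_max => //; rewrite leqnn first_root.
by case/and5P => /IHl.
Qed.

Lemma entry_eq (i j : nat) : uniq p -> i < size p -> j < size p ->
  entry p i = entry p j -> i = j.
Proof. by move=> up ip jp /eqP; rewrite nth_uniq // => /eqP. Qed.

(* A tree whose left spine exceeds the open descent [root l] absorbs
   the tree [l]: that descent is closed as soon as it can be. *)
Lemma canonical_merge (l t : ptree) : uniq p -> canonical_tree l ->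
    canonical_tree t -> first t = (root l).+1 -> root t < size p ->
    entry p (root l) < spine t ->
  exists u, [/\ canonical_tree u, first u = first l & root u = root t].
Proof.
move=> up wl; elim: t => /= [a _ -> _ lt|t IH /andP[wt ltt] e tp lt|a IHa b
  IHb].
- by exists (POne l); rewrite /= wl.
- case: (ltngtP (entry p (root l)) (spine t)) => h.
  + have [u [wu fu ru]] := IH wt e (ltnW tp) h.
    by exists (POne u); rewrite /= wu fu ru.
  (* The spine of [t] stays below [root l], but the unary root exceeds it and becomes the northeast
     endpoint of that hook. *)
  + by exists (PTwo l t); rewrite /= wl wt e eqxx h lt ltt.
  + have [i /andP[fi ir] si] := spine_entry wt; move: h; rewrite si.
    have il : root l < i by rewrite -e.
    have ip : i < size p by apply: leq_ltn_trans ir (ltnW tp).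
    move/(entry_eq up (ltn_trans il ip) ip) => e'.
    by rewrite e' ltnn in il.
case/and5P => wa wb e1 h1 /andP[h2 h3] e bp lt.
have ab : root a < (root b).+1.
  by rewrite -(eqP e1); apply/leqW/first_root.
have [u [wu fu ru]] := IHa wa e (leq_trans ab (ltnW bp)) lt.
by exists (PTwo u b); rewrite /= wu wb fu ru e1 h1 h2 h3.
Qed.

End CanonicalTrees.

(** * Canonical trees of stack-sorted words *)

Lemma uniq_max_split (w : seq nat) : uniq w -> 0 < size w ->
  exists L m R, w = L ++ m :: R /\ all (fun x => x < m) (L ++ R).
Proof.
case: w => // x w; set s := x :: w => us _.
have := bigmax_seq_mem x w; rewrite -/s; set m := \max_(_ <- _) _ => ms.
exists (take (index m s) s), m, (drop (index m s).+1 s).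
have es : s = take (index m s) s ++ m :: drop (index m s).+1 s.
  rewrite -{1}(cat_take_drop (index m s) s).
  by rewrite (drop_nth 0) ?index_mem // nth_index.
split=> //; apply/allP => z zs.
have pm : perm_eq s (m :: take (index m s) s ++ drop (index m s).+1 s).
  by rewrite {1}es perm_catC /= perm_cons perm_catC.
have zin : z \in s by rewrite (perm_mem pm) inE zs orbT.
have : z != m.
  apply: contraTneq zs => ->; move: us; rewrite (perm_uniq pm) /=.
  by case/andP.
by rewrite ltn_neqAle => -> /=; apply: leq_bigmax_seq.
Qed.

Lemma perm_stack_sort (w : seq nat) : uniq w -> perm_eq (stack_sort w) w.
Proof.
have [k] := ubnP (size w); elim: k w => // k IH w; rewrite ltnS => wk uw.
case: (posnP (size w)) => [/size0nil -> //|/(uniq_max_split uw)].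
case=> L [m [R [e ltm]]]; rewrite e stack_sort_cat //.
move: uw; rewrite e cat_uniq /= => /and3P[uL _ /andP[_ uR]].
move: wk; rewrite e size_cat /= addnS => wk.
have pL := IH L (leq_ltn_trans (leq_addr _ _) wk) uL.
have pR := IH R (leq_ltn_trans (leq_addl _ _) wk) uR.
by rewrite perm_cat // cats1 perm_rcons perm_cons.
Qed.

Lemma nth_cat_mid (pre w post : seq nat) (i : nat) : i < size w ->
  entry (pre ++ w ++ post) (size pre + i) = entry w i.
Proof. by move=> iw; rewrite nth_cat ltnNge leq_addr /= addKn nth_cat iw. Qed.

(** The maximum [m] comes last, after the images of both sides, which carry trees by induction. If
    the left root lies below the spine of the right tree, [canonical_merge] joins them under a unary
    root; otherwise [m] closes the hook of the left root. The context [pre], [post] keeps all trees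
    in one word. *)
Lemma stack_sort_canonical_tree (pre post w : seq nat) :
    let p := pre ++ stack_sort w ++ post in
    uniq w -> uniq p -> 0 < size w ->
  exists t, [/\ canonical_tree p t, first t = size pre &
                (root t).+1 = size pre + size w].
Proof.
have [k] := ubnP (size w); elim: k w pre post => // k IH w pre post.
rewrite ltnS => wk p uw up w0; move: up; rewrite {}/p.
have [L [m [R [e ltm]]]] := uniq_max_split uw w0; rewrite e stack_sort_cat //.
move: uw; rewrite e cat_uniq /= => /and3P[uL _ /andP[_ uR]].
move: wk; rewrite e size_cat /= addnS => wk.
have wkL := leq_ltn_trans (leq_addr _ _) wk.
have wkR := leq_ltn_trans (leq_addl _ _) wk.
have pL := perm_stack_sort uL; have pR := perm_stack_sort uR.
have sL := perm_size pL; have sR := perm_size pR.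
set p := pre ++ _ => up.
have eL : p = pre ++ stack_sort L ++ (stack_sort R ++ m :: post).
  by rewrite /p -!catA.
have eR : p = (pre ++ stack_sort L) ++ stack_sort R ++ m :: post.
  by rewrite /p -!catA.
have em : entry p (size pre + size L + size R) = m.
  by rewrite eR nth_cat size_cat sL ltnNge leq_addr /= addKn nth_cat sR ltnn
    subnn.
have ltLm i : size pre <= i < size pre + size L -> entry p i < m.
  case/andP => i1 i2; rewrite -(subnKC i1) eL.
  have iL : i - size pre < size (stack_sort L) by rewrite sL ltn_subLR.
  rewrite nth_cat_mid //; move/allP: ltm; apply.
  by rewrite mem_cat -(perm_mem pL) mem_nth.
have ltRm i : size pre + size L <= i < size pre + size L + size R ->
  entry p i < m.
  case/andP; rewrite -sL -size_cat => i1 i2; rewrite -(subnKC i1) eR.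
  have iR : i - size (pre ++ stack_sort L) < size (stack_sort R).
    by rewrite sR ltn_subLR.
  rewrite nth_cat_mid //; move/allP: ltm; apply.
  by rewrite mem_cat -(perm_mem pR) mem_nth ?orbT.
have szp : size pre + size L + size R < size p.
  by rewrite /p !size_cat sL sR /= addn1 -!addnA !ltn_add2l ltn_addr.
have HL : 0 < size L -> exists t, [/\ canonical_tree p t, first t = size pre &
                (root t).+1 = size pre + size L].
  by move=> L0; have := IH L pre (stack_sort R ++ m :: post) wkL uL;
    rewrite -eL; apply.
have HR : 0 < size R -> exists t, [/\ canonical_tree p t,
    first t = size pre + size L & (root t).+1 = size pre + size L + size R].
  move=> R0; have := IH R (pre ++ stack_sort L) (m :: post) wkR uR; rewrite -eR.
  by rewrite size_cat sL; apply.
rewrite addnS addnA.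
have one t : canonical_tree p t -> (root t).+1 = size pre + size L + size R ->
    entry p (root t) < m -> canonical_tree p (POne t).
  by move=> wt rt lt /=; rewrite wt rt em.
case: (posnP (size L)) => [L0|/HL [tl [wl fl rl]]].
  case: (posnP (size R)) => [R0|/HR [tr [wr fr rr]]].
    by exists (PLeaf (size pre)); rewrite /= L0 R0 !addn0.
  exists (POne tr); split; first 1 last.
  - by rewrite /= fr L0 addn0.
  - by rewrite /= rr.
  by apply: one => //; apply: ltRm; rewrite -rr ltnSn andbT -fr (first_root wr).
have ltl : entry p (root tl) < m.
  by apply: ltLm; rewrite -rl ltnSn andbT -fl (first_root wl).
case: (posnP (size R)) => [R0|/HR [tr [wr fr rr]]].
  exists (POne tl); split=> //; first by apply: one; rewrite // rl R0 addn0.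
  by rewrite /= rl R0 addn0.
have ltr : entry p (root tr) < m.
  by apply: ltRm; rewrite -rr ltnSn andbT -fr (first_root wr).
have e1 : first tr = (root tl).+1 by rewrite fr rl.
have rp : root tr < size p by rewrite -ltnS rr ltnW.
case: (ltngtP (entry p (root tl)) (spine p tr)) => h.
- have [u [wu fu ru]] := canonical_merge up wl wr e1 rp h.
  by exists (POne u); split; rewrite ?one //= ?fu ?ru // rr.
- exists (PTwo tl tr); rewrite /= fl rr; split=> //.
  by rewrite wl wr e1 eqxx h em ltl ltr.
have [i /andP[fi ir] si] := spine_entry wr; move: h; rewrite si.
have il : root tl < i by rewrite -e1.
have ip : i < size p by apply: leq_ltn_trans ir rp.
move/(entry_eq up (ltn_trans il ip) ip) => e'.
by rewrite e' ltnn in il.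
Qed.

Lemma sorted_canonical_tree (p : seq nat) : sorted_perm p ->
  exists t, [/\ canonical_tree p t, first t = 0 & (root t).+1 = size p].
Proof.
case=> /and3P[p0 up _] [w /and3P[w0 uw _] e].
have sz : size w = size p by rewrite -e (perm_size (perm_stack_sort uw)).
have := @stack_sort_canonical_tree [::] [::] w uw.
by rewrite /= cats0 e add0n sz; apply; rewrite // -sz.
Qed.

(** * Scanning a permutation *)

Section Scans.
Variable p : seq nat.

Definition push (j : nat) (S : seq nat) : seq nat :=
  if j \in descents p then j :: S else S.

Definition top_color (c0 : nat) (S : seq nat) : nat :=
  if S is d :: _ then d.+1 else c0.

Definition closable (j : nat) (S : seq nat) : bool :=
  if S is d :: _ then entry p d < entry p j else false.

Definition step (j : nat) (S : seq nat) (b : bool) : seq nat :=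
  push j (if b then behead S else S).

(* The word [bs] tells, for the positions from [j] on, whether they are
   northeast endpoints; [S] is the stack of the descents whose hooks are open.
   A northeast endpoint closes the hook on top of the stack; another position
   gets the color of that hook, named [d.+1] when [d] is its descent, and [c0]
   if the stack is empty. *)
Fixpoint scan (j : nat) (S : seq nat) (bs : seq bool) : seq nat :=
  if bs is b :: bs' then scan j.+1 (step j S b) bs' else S.

Fixpoint valid_scan (j : nat) (S : seq nat) (bs : seq bool) : bool :=
  if bs is b :: bs' then (b ==>
    closable j S) && valid_scan j.+1 (step j S b) bs'
  else true.

Fixpoint colors (c0 j : nat) (S : seq nat) (bs : seq bool) : seq nat :=
  if bs is b :: bs' then
    nseq (~~ b) (top_color c0 S) ++ colors c0 j.+1 (step j S b) bs'
  else [::].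

Lemma scan_cat (j : nat) (S : seq nat) (bs1 bs2 : seq bool) :
  scan j S (bs1 ++ bs2) = scan (j + size bs1) (scan j S bs1) bs2.
Proof. by elim: bs1 j S => [|b bs1 IH] j S /=;
  rewrite ?addn0 // IH addSnnS. Qed.

Lemma valid_scan_cat (j : nat) (S : seq nat) (bs1 bs2 : seq bool) :
  valid_scan j S (bs1 ++ bs2) =
  valid_scan j S bs1 && valid_scan (j + size bs1) (scan j S bs1) bs2.
Proof.
by elim: bs1 j S => [|b bs1 IH] j S /=; rewrite ?addn0 // IH addSnnS andbA.
Qed.

Lemma colors_cat (c0 j : nat) (S : seq nat) (bs1 bs2 : seq bool) :
  colors c0 j S (bs1 ++ bs2) =
  colors c0 j S bs1 ++ colors c0 (j + size bs1) (scan j S bs1) bs2.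
Proof.
by elim: bs1 j S => [|b bs1 IH] j S /=; rewrite ?addn0 // IH addSnnS catA.
Qed.

Lemma mem_descents (i : nat) :
  (i \in descents p) = (i.+1 < size p) && (entry p i.+1 < entry p i).
Proof. by rewrite mem_filter mem_iota /= add0n andbC; case: (size p). Qed.

Lemma ascent_notin (i : nat) : entry p i < entry p i.+1 -> i \notin descents p.
Proof. by move=> lt; rewrite mem_descents (ltnNge _ (entry p i)) (ltnW lt)
  andbF. Qed.

Lemma notin_descents (i : nat) : uniq p -> i.+1 < size p ->
  i \notin descents p ->
  entry p i < entry p i.+1.
Proof.
move=> uniq_p ip; rewrite mem_descents ip /= -leqNgt leq_eqVlt => /orP[/eqP|//].
by move/(entry_eq uniq_p (ltnW ip) ip)/n_Sn.
Qed.

Lemma pushF (i : nat) (S : seq nat) : entry p i < entry p i.+1 -> push i S = S.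
Proof. by move=> /ascent_notin; rewrite /push => /negPf ->. Qed.

Lemma push_cat (j : nat) (S B : seq nat) : push j (S ++ B) = push j S ++ B.
Proof. by rewrite /push; case: ifP. Qed.

(** The root is left out, since whether it is a descent depends on the entry after the tree. *)
Definition ptree_descents (t : ptree) : seq nat :=
  [seq d <- iota (first t) (root t - first t) | entry p d.+1 < entry p d].

Lemma canonical_descent (l r : ptree) : canonical_tree p (PTwo l r) ->
  entry p (root l).+1 < entry p (root l).
Proof.
case/and5P => _ wr /eqP <- + _; apply: leq_ltn_trans; exact: first_spine.
Qed.

Lemma ptree_descents_one (t : ptree) : canonical_tree p (POne t) ->
  ptree_descents (POne t) = ptree_descents t.
Proof.
case/andP => wt lt; rewrite /ptree_descents /= (subSn (first_root wt)).
rewrite -addn1 iotaD filter_cat /= subnKC ?(first_root wt) //.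
by rewrite ltnNge (ltnW lt) /= cats0.
Qed.

Lemma ptree_descents_two (l r : ptree) : canonical_tree p (PTwo l r) ->
  ptree_descents (PTwo l r) = ptree_descents l ++ root l :: ptree_descents r.
Proof.
move=> w; have dl := canonical_descent w; rewrite /ptree_descents /=.
case/and5P: w => wl wr /eqP e _ /andP[_ lt].
have fl := first_root wl; have fr := first_root wr; rewrite e in fr *.
have -> : (root r).+1 - first l =
    (root l - first l) + (1 + (root r - (root l).+1 + 1)) by lia.
rewrite !iotaD !filter_cat /= subnKC // !addn1 subnKC // dl /=.
by rewrite ltnNge (ltnW lt) /= cats0.
Qed.

(** The first leaf of a right subtree comes right after the descent [root l]. This is why the color
    of the hook from [d] is named [d.+1]: color names are leaves. *)
Lemma leavesE (t : ptree) : canonical_tree p t ->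
  leaves t = first t :: [seq d.+1 | d <- ptree_descents t].
Proof.
elim: t => [a _|t IH w|l IHl r IHr w]; first
  by rewrite /ptree_descents /= subnn.
  by rewrite ptree_descents_one //= IH //; case/andP: w.
rewrite ptree_descents_two //= map_cat /=.
by case/and5P: w => wl wr /eqP <- _ _; rewrite (IHl wl) (IHr wr).
Qed.

Lemma first_leaf (t : ptree) : canonical_tree p t -> first t \in leaves t.
Proof. by move=> wt; rewrite leavesE ?mem_head. Qed.

End Scans.

(** * Color choices along a tree *)

Fixpoint colorings (t : ptree) (cs : seq nat) : Prop :=
  match t with
  | PLeaf a => perm_eq cs [:: a]
  | POne t => exists c ds,
      [/\ c \in leaves t, colorings t ds & perm_eq cs (c :: ds)]
  | PTwo l r => exists ds es,
      [/\ colorings l ds, colorings r es & perm_eq cs (ds ++ es)]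
  end.

Section ScansColorings.
Variable p : seq nat.

Lemma rcons_split (T : Type) (n : nat) (s : seq T) : size s = n.+1 ->
  exists s' x, s = rcons s' x /\ size s' = n.
Proof.
case/lastP: s => // s x; rewrite size_rcons => -[sn].
by exists s, x.
Qed.

(* Reading the subtree [t], the scan may leave some hooks open; every such
   hook accounts for one color more than in a coloring of [t]. *)
Lemma scan_colorings (t : ptree) (S : seq nat) (bs : seq bool) :
    canonical_tree p t -> root t < size p -> (root t).+1 = first t + size bs ->
    valid_scan p (first t) S bs -> top_color 0 S = first t ->
    (if S is d :: _ then spine p t < entry p d else true) ->
  exists O ds es,
    [/\ scan p (first t) S bs = push p (root t) (O ++ S),
        perm_eq (colors p 0 (first t) S bs) (ds ++ es), colorings t ds,
        size es = size O & {subset es <= leaves t} /\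
                           {subset [seq d.+1 | d <- O] <= leaves t}].
Proof.
elim: t S bs => [a|t IH|l IHl r IHr] S bs /=.
- move=> _ ap /eqP; rewrite -addn1 eqn_add2l eq_sym => /eqP.
  case: bs => [|b [|//]] //= _; rewrite andbT => vb tS sS.
  have {vb} -> : b = false.
    case: b vb => //=; case: S sS {tS} => //= d S /ltnW.
    by rewrite leqNgt => /negPf ->.
  by exists [::], [:: a], [::]; rewrite /= tS.
- move=> /andP[wt lt] tp.
  case/lastP: bs => [|bs b]; first by move=> /= e; have := first_root wt; lia.
  rewrite size_rcons addnS => -[sz].
  rewrite -cats1 valid_scan_cat scan_cat colors_cat -sz /= andbT cats0 /step.
  case/andP => vbs vb tS sS.
  have [|O [ds [es [eO pc cds es_O [les lO]]]]] :=
    IH S bs wt (ltnW tp) sz vbs tS.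
    case: S sS {vbs vb tS} => // d S; apply: leq_trans; rewrite ltnS.
    exact: leq_trans (spine_root wt) (ltnW lt).
  rewrite {}eO (pushF _ lt) in vb *.
  case: b vb => /= vb; last first.
    exists O, (top_color 0 (O ++ S) :: ds), es; split=> //.
      by rewrite perm_catC /= perm_cons.
    exists (top_color 0 (O ++ S)), ds; split=> //.
    case: O {es_O vb} lO => [|o O] lO /=; last by apply: lO; rewrite mem_head.
    by rewrite tS (first_leaf wt).
  (* If the root closes a hook, that hook was opened inside [t], as the top of [S] is higher than
     the root. One surplus color [e] then becomes the choice of the root. *)
  case: O vb es_O lO => [|o O] vb es_O lO.
    by case: S vb sS {vbs tS pc} => //= d S lt1 lt2; have := ltn_trans lt1 lt2;
      rewrite ltnn.
  case: es es_O les pc => // e es [es_O] les pc.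
  exists O, (e :: ds), es; split=> //.
  - by rewrite cats0 (perm_trans pc) // -(cat1s e es) perm_catCA.
  - by exists e, ds; split=> //; apply: les; rewrite mem_head.
  by split=> x xs; [apply: les|apply: lO]; rewrite inE xs orbT.
move=> w rp; have dl := canonical_descent w.
case/and5P: w => wl wr /eqP e s1 /andP[lt1 lt2] sz vbs tS sS.
have fl := first_root wl; have fr := first_root wr; rewrite e in fr.
have [bs1 [bs2 [b [ebs sz1 sz2]]]] : exists bs1 bs2 b,
    [/\ bs = bs1 ++ bs2 ++ [:: b], (root l).+1 = first l + size bs1
      & (root r).+1 = first r + size bs2].
  have sbs : size bs = ((root l).+1 - first l + (root r - root l)).+1 by lia.
  have [bs' [b [-> sbs']]] := rcons_split sbs.
  exists (take ((root l).+1 - first l) bs'), (drop ((root l).+1 - first l)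
    bs'), b.
  rewrite size_takel ?size_drop ?sbs' ?leq_addr // catA cat_take_drop cats1 e.
  by split=> //; lia.
move: vbs; rewrite {}ebs !valid_scan_cat !scan_cat !colors_cat -sz1.
case/and3P => vb1.
have dl' : root l \in descents p by rewrite mem_descents dl andbT; lia.
have rl : root l < size p by lia.
have [O1 [ds1 [es1 [eO1 pc1 cds1 es_O1 [les1 lO1]]]]] :=
  IHl S bs1 wl rl sz1 vb1 tS sS.
rewrite eO1 /push dl' -e => vb2.
(* The right subtree is read with [root l] on top of the stack: its color name is [first r], and its
   entry exceeds [spine r], as the induction hypothesis asks. *)
have [O2 [ds2 [es2 [eO2 pc2 cds2 es_O2 [les2 lO2]]]]] :=
  IHr (root l :: O1 ++ S) bs2 wr (ltnW rp) sz2 vb2 (esym e) s1.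
rewrite eO2 -sz2 (pushF _ lt2) /= andbT /step cats0 => vb.
have lO : {subset [seq d.+1 | d <- O2 ++ root l :: O1] <= leaves l ++ leaves r}.
  move=> x; rewrite map_cat !mem_cat /= inE -e =>
    /or3P[/lO2 ->|/eqP ->|/lO1 -> //].
    by rewrite orbT.
  by rewrite (first_leaf wr) orbT.
have les : {subset es1 ++ es2 <= leaves l ++ leaves r}.
  by move=> x; rewrite !mem_cat => /orP[/les1|/les2] ->; rewrite ?orbT.
have pc : perm_eq (colors p 0 (first l) S bs1 ++ colors p 0 (first r) (root l
  :: O1 ++ S) bs2)
    ((ds1 ++ ds2) ++ es1 ++ es2).
  by rewrite (perm_trans (perm_cat pc1 pc2)) // perm_catACA.
have -> : O2 ++ root l :: O1 ++ S = (O2 ++ root l :: O1) ++ S by rewrite -catA.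
(* The descent [root l] puts the open hooks one ahead of the surplus colors. The root restores the
   balance, adding its own color to the surplus or closing a hook. *)
have sO : size (O2 ++ root l :: O1) = (size (es1 ++ es2)).+1.
  by rewrite !size_cat /= es_O1 es_O2 addnS addnC.
case: b vb => /= vb; last first.
  exists (O2 ++ root l :: O1), (ds1 ++ ds2), (top_color 0 ((O2 ++ root l :: O1)
    ++ S) :: es1 ++ es2).
  split=> //.
  - by rewrite catA perm_catC /= perm_sym perm_catC /= perm_cons perm_catC
      perm_sym.
  - by exists ds1, ds2.
  split=> // x; rewrite inE => /orP[/eqP ->|/les //].
  by apply: lO; case: (O2) => [|o O] /=; rewrite mem_head.
case eO : (O2 ++ root l :: O1) => [|o O]; first by case: (O2) eO.
exists O, (ds1 ++ ds2), (es1 ++ es2); split=> //.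
- by rewrite cats0.
- by exists ds1, ds2.
- by move: sO; rewrite eO => -[].
by split=> // x xs; apply: lO; rewrite eO /= inE xs orbT.
Qed.
End ScansColorings.

(** * Realizing all colorings *)

Section ColoringsScan.
Variables (p : seq nat) (c0 : nat).

(** Here [last j U] is the bottom of the stack [U], or the current position if [U] is empty. The
    bound lets a hook hidden under [U] be closed once [U] is exhausted; it survives since a
    non-descent is followed by a larger entry. *)
Lemma last_push (x : nat) (j : nat) (U : seq nat) : uniq p -> j.+1 < size p ->
  x < entry p (last j U) -> x < entry p (last j.+1 (push p j U)).
Proof.
move=> up jp; rewrite /push; case: ifPn => // jd; case: U => // /ltn_trans.
by apply; apply: notin_descents.
Qed.

(* Two exchange arguments on a scan ending with an empty stack, with one
   position appended to the word.  First, an extra open hook can be carried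
   below [U] and closed later, the hooks of [S] being delayed in turn, without
   changing the colors.  Second, any color can be added: reopen the hook of
   that color when it would close, and carry it along. *)
Lemma scan_extend (bs : seq bool) (j : nat) : uniq p -> j + size bs < size p ->
  (forall U i S, scan p j (U ++ S) bs = [::] -> valid_scan p j (U ++ S) bs ->
     entry p i < entry p (last j U) ->
   exists bs', [/\ size bs' = (size bs).+1, valid_scan p j (U ++ i :: S) bs',
     scan p j (U ++ i :: S) bs' = push p (j + size bs) [::] &
     perm_eq (colors p c0 j (U ++ i :: S) bs') (colors p c0 j (U ++ S) bs)]) /\
  (forall S c, scan p j S bs = [::] -> valid_scan p j S bs ->
     c = c0 \/ (exists2 d, c = d.+1 &
       (d \in S) || ((j <= d < j + size bs) && (d \in descents p))) ->
   exists bs', [/\ size bs' = (size bs).+1, valid_scan p j S bs',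
     scan p j S bs' = push p (j + size bs) [::] &
     perm_eq (colors p c0 j S bs') (c :: colors p c0 j S bs)]).
Proof.
move=> up; elim: bs j => [|b bs IH] j /=.
  rewrite addn0 => jp; split.
    by case=> // i [] // _ _ lt; exists [:: true]; rewrite /= lt.
  move=> S c -> _ ec; exists [:: false]; rewrite /=; split=> //.
  by case: ec => [-> //|[d _ /andP[/andP[jd]]]]; rewrite ltnNge jd.
rewrite addnS => jp; have jp1 : j.+1 < size p by lia.
have [IHA IHC] := IH j.+1 jp; split.
  case=> [|u U] i S /=; last first.
    move=> sc /andP[cl vs] lt.
    have eU X : step p j (u :: U ++ X) b = push p j (if b then U else u :: U)
      ++ X.
      by rewrite /step -push_cat; case: b {sc cl vs}.
    rewrite !eU in sc vs *.
    have lt' : entry p i < entry p (last j (if b then U else u :: U)).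
      case: b cl {sc vs eU} => //= cl; case: U lt => //= lt.
      exact: ltn_trans lt cl.
    have [bs' [sz vs' sc' pc]] := IHA _ i S sc vs (last_push up jp1 lt').
    by exists (b :: bs'); rewrite /= sz eU vs' sc' cl perm_cat2l pc addSn.
  (* Position [j] was colored by the top of [S]: it now closes [i], and the lost color is added back
     by the second statement. *)
  case: b => /=; last first.
    move=> sc vs lt; have [|bs' [sz vs' sc' pc]] :=
      IHC _ (top_color c0 S) sc vs.
      case: S {sc vs lt} => [|d S]; [by left|right]; exists d => //.
      by rewrite /step /push; case: ifP; rewrite !inE eqxx ?orbT.
    by exists (true :: bs'); rewrite /= sz lt vs' sc' addSn; split.
  (* Position [j] was closing [m]: it closes [i] instead, and [m] becomes the delayed hook. *)
  case: S => //= m S; rewrite /step /= => sc /andP[cl vs] lt.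
  have eP X : push p j X = push p j [::] ++ X by rewrite -push_cat.
  rewrite eP in sc vs *.
  have [bs' [sz vs' sc' pc]] := IHA _ m S sc vs (last_push (U :=
    [::]) up jp1 cl).
  exists (true :: bs'); rewrite /= sz lt /step /= eP vs' sc' addSn; split=> //.
move=> S c sc /andP[cl vs] ec.
have keep : c = c0 \/ (exists2 d, c = d.+1 &
    (d \in step p j S b) || ((j.+1 <= d < j.+1 + size bs) && (d \in descents
      p))) ->
  exists bs', [/\ size bs' = (size bs).+2,
     valid_scan p j S bs', scan p j S bs' = push p (j + size bs).+1 [::] &
     perm_eq (colors p c0 j S bs')
       (c :: nseq (~~ b) (top_color c0 S) ++ colors p c0 j.+1 (step p j S b)
         bs)].
  move=> ec'; have [bs' [sz vs' sc' pc]] := IHC _ c sc vs ec'.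
  exists (b :: bs'); rewrite /= sz cl vs' sc' addSn; split=> //.
  by rewrite -(cat1s c) perm_sym perm_catCA perm_cat2l perm_sym.
case: ec => [|[d ecd hd]]; first by move=> e; apply: keep; left.
have keep' : (d \in if b then behead S else S) || (d \notin S) ->
    exists bs', [/\ size bs' = (size bs).+2,
       valid_scan p j S bs', scan p j S bs' = push p (j + size bs).+1 [::] &
       perm_eq (colors p c0 j S bs')
         (c :: nseq (~~ b) (top_color c0 S) ++ colors p c0 j.+1 (step p j S b)
           bs)].
  move=> dS; apply: keep; right; exists d => //; rewrite /step.
  case/orP: dS => [dS|/negPf dS]; first by rewrite /push; case: ifP;
    rewrite ?inE dS ?orbT.
  move: hd; rewrite dS /= => /andP[/andP[jd djs] dd].
  case: (eqVneq d j) => [ej|ndj]; first by rewrite /push -ej dd mem_head.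
  by rewrite dd andbT addSn djs andbT ltn_neqAle eq_sym ndj jd orbT.
case: b sc cl vs keep' {keep} => /= sc cl vs keep'; last first.
  by apply: keep'; case: (d \in S).
case: S cl sc vs keep' {hd} => //= m S; rewrite /step /= => cl sc vs keep'.
case: (eqVneq d m) keep' => [ed _|ndm]; last first.
  by rewrite inE (negPf ndm) /=; apply; case: (d \in S).
have eP X : push p j X = push p j [::] ++ X by rewrite -push_cat.
rewrite eP in sc vs *.
have [bs' [sz vs' sc' pc]] := IHA _ m S sc vs (last_push (U := [::]) up jp1 cl).
(* The wanted color is that of the hook [m] closing at [j]: leaving it open gives [j] this color,
   and [m] is delayed. *)
exists (false :: bs'); rewrite /= sz /step /= (eP (m :: S)) vs' sc' addSn;
  split=> //.
by rewrite ecd ed perm_cons.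
Qed.

(** A valid scan from [S] never closes a hook below [S], so [B] only shows through as the color seen
    where the stack would be empty. *)
Lemma colors_shift (B : seq nat) (j : nat) (S : seq nat) (bs : seq bool) :
  valid_scan p j S bs ->
  [/\ valid_scan p j (S ++ B) bs, scan p j (S ++ B) bs = scan p j S bs ++ B &
      colors p c0 j (S ++ B) bs = colors p (top_color c0 B) j S bs].
Proof.
elim: bs j S => //= b bs IH j S /andP[cl vs].
have -> : step p j (S ++ B) b = step p j S b ++ B.
  by rewrite /step -push_cat; case: b cl {vs} => //; case: S.
have [-> -> ->] := IH _ _ vs; split=> //; rewrite ?andbT.
  by case: b cl {vs} => //; case: S.
by congr (_ ++ _); case: S cl {vs} => //=; case: b.
Qed.

End ColoringsScan.

(** A unary vertex adds its chosen color by [scan_extend]. At a binary vertex the two scans are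
    concatenated, the second one above [root l], and a final bit closes that hook. *)
Lemma colorings_scan (p : seq nat) (t : ptree) (cs : seq nat) :
    uniq p -> canonical_tree p t -> root t < size p -> colorings t cs ->
  exists bs, [/\ (root t).+1 = first t + size bs,
    valid_scan p (first t) [::] bs,
    scan p (first t) [::] bs = push p (root t) [::] &
    perm_eq (colors p (first t) (first t) [::] bs) cs].
Proof.
move=> up; elim: t cs => [a|t IH|l IHl r IHr] cs /=.
- move=> _ _ pc; exists [:: false]; rewrite /= addn1 perm_sym; split=> //.
- move=> /andP[wt lt] tp [c [ds [ct /(IH _ wt (ltnW tp)) [bs [sz vs sc pc]]
    pc']]].
  have jp : first t + size bs < size p by rewrite -sz.
  have [_ /(_ [::] c)] := scan_extend (first t) up jp.
  rewrite sc (pushF _ lt) => /(_ (erefl _) vs) [|bs' [sz' vs' sc' pc'']].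
    move: ct; rewrite (leavesE wt) inE => /orP[/eqP ->|]; first by left.
    case/mapP => d; rewrite mem_filter mem_iota subnKC ?(first_root wt) //.
    case/and3P => dd d1 d2 ->; right; exists d => //=.
    by rewrite -sz d1 leqW // mem_descents dd andbT; lia.
  exists bs'; rewrite sz' addnS -sz vs' sc' -sz; split=> //.
  by rewrite (perm_trans pc'') // perm_sym (perm_trans pc') // perm_cons
    perm_sym.
move=> w rp [ds [es [cds ces pc]]]; have dl := canonical_descent w.
case/and5P: w => wl wr /eqP e s1 /andP[lt1 lt2].
have fl := first_root wl; have fr := first_root wr; rewrite e in fr.
have rl : root l < size p by lia.
have [bs1 [sz1 vs1 sc1 pc1]] := IHl _ wl rl cds.
have [bs2 [sz2 vs2 sc2 pc2]] := IHr _ wr (ltnW rp) ces.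
have [vs2' sc2' pc2'] := colors_shift (first l) [:: root l] vs2.
have dl' : root l \in descents p by rewrite mem_descents dl andbT; lia.
exists (bs1 ++ bs2 ++ [:: true]).
rewrite !valid_scan_cat !scan_cat !colors_cat -sz1 sc1 /push dl' -e vs1 vs2'
  sc2'.
rewrite -sz2 sc2 (pushF _ lt2) /= lt1; split=> //.
  by rewrite !size_cat /=; lia.
rewrite cats0 perm_sym (perm_trans pc) // perm_sym perm_cat //.
by rewrite pc2' /= -e.
Qed.

(** * Valid hook configurations as scans *)

(** The noncrossing condition in terms of positions only, without the real plane. *)
Definition laminar (p : seq nat) (H : seq hook) : Prop :=
  [/\ all (is_hook p) H, [seq h.1 | h : hook <- H] = descents p,
      forall (h : hook) m, h \in H -> ~~ directly_above p m h &
      forall g h : hook, g \in H -> h \in H -> g.1 < h.1 ->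
        g.2 <= h.1 \/ h.2 < g.2].

Lemma descents_sorted (p : seq nat) : sorted ltn (descents p).
Proof. by apply: sorted_filter (iota_ltn_sorted _ _); exact: ltn_trans. Qed.

Lemma descents_uniq (p : seq nat) : uniq (descents p).
Proof. by rewrite filter_uniq ?iota_uniq. Qed.

Lemma uniq_map_inj (T1 T2 : eqType) (f : T1 -> T2) (s : seq T1) (x y : T1) :
  uniq (map f s) -> x \in s -> y \in s -> f x = f y -> x = y.
Proof.
elim: s => //= z s IH /andP[zs us]; rewrite !inE.
case/orP => [/eqP ->|xs] /orP[/eqP ->|ys] // e; last exact: IH.
  by move: zs; rewrite e map_f.
by move: zs; rewrite -e map_f.
Qed.

Lemma VHC_laminar (R : realType) (p : seq nat) (H : seq hook) : uniq p ->
  VHC R p H <-> laminar p H.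
Proof.
move=> up; split=> [[hH dH aH cH]|[hH dH aH lH]]; split=> //.
  move=> g h gH hH' lt; case: (leqP g.2 h.1) => h1; [by left|right].
  rewrite ltnNge; apply/negP => h2.
  have /and3P[g12 gp _] := allP hH g gH; have /and3P[h12 hp _] := allP hH h hH'.
  have ah : entry p h.1 <= entry p g.2.
    by have := aH g h.1 gH; rewrite /directly_above lt h1 /= -leqNgt.
  have ag : entry p g.2 <= entry p h.2.
    move: h2; rewrite leq_eqVlt => /orP[/eqP -> //|h2].
    by have := aH h g.2 hH'; rewrite /directly_above h1 h2 /= -leqNgt.
  have gh : g <> h by move=> e; rewrite e ltnn in lt.
  (* If [h] started under [g] and ended no earlier, the vertical side of [h] would cross the
     horizontal side of [g] at this point. *)
  have [||[/(congr1 fst) /= /eqP]|[/(congr1 fst) /= /eqP]] :=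
      cH g h (h.1%:R, (entry p g.2)%:R)%R gH hH' gh.
  - by right; rewrite /= !ler_nat (ltnW lt) (ltnW h1).
  - by left; rewrite /= !ler_nat ah ag.
  - by rewrite eqr_nat => /eqP e; rewrite e ltnn in h1.
  - by rewrite eqr_nat => /eqP e; rewrite e ltnn in h12.
have us : uniq [seq h.1 | h : hook <- H] by rewrite dH descents_uniq.
(* A common point is on the horizontal side of [g]. A hook [h] nested under [g] stays strictly
   lower, so [g] must end where [h] starts. *)
have meet g h z : g \in H -> h \in H -> g.1 < h.1 ->
    hook_curve p g z -> hook_curve p h z ->
    z = plot_point R p g.2 /\ z = plot_point R p h.1.
  move=> gH hH' lt zg zh.
  have /and3P[g12 gp _] := allP hH g gH.
  have /and3P[h12 hp hl] := allP hH h hH'.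
  have [z1 z2] : ((h.1)%:R <= z.1 /\ z.2 <= (entry p h.2)%:R)%R.
    by case: zh => /= -[-> /andP[]] //; split.
  have [ez gz] : (z.2 = (entry p g.2)%:R /\ z.1 <= (g.2)%:R)%R.
    case: zg => /= -[e /andP[]] //.
    by move: z1; rewrite e ler_nat leqNgt lt.
  have [le|lt2] := lH g h gH hH' lt.
    have e : g.2 = h.1.
      apply/eqP; rewrite eqn_leq le /= -(ler_nat R).
      exact: Order.POrderTheory.le_trans z1 gz.
    have ez1 : (z.1 = (g.2)%:R)%R.
      by apply/eqP; rewrite Order.POrderTheory.eq_le gz e z1.
    by rewrite /plot_point -e -ez -ez1; case: (z).
  have /negP[] := aH g h.2 gH; rewrite /directly_above (ltn_trans lt h12) lt2
    /=.
  rewrite ltn_neqAle -(ler_nat R) -ez z2 andbT.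
  apply/eqP => /(entry_eq up gp hp) e; by rewrite e ltnn in lt2.
move=> g h z gH hH' gh zg zh; case: (ltngtP g.1 h.1) => lt.
- by left; apply: meet.
- by right; apply: meet.
by case: gh; apply: uniq_map_inj us gH hH' lt.
Qed.

Section LaminarScan.
Variables (p : seq nat) (H : seq hook).
Hypotheses (up : uniq p) (lamH : laminar p H).

(** The stack before [j] is read: a hook ending at [j] is still on it, and the reversal puts the
    latest descent on top. *)
Definition open_hooks (j : nat) : seq nat :=
  rev [seq h.1 | h : hook <- H & h.1 < j <= h.2].

Definition northeast (j : nat) : bool := j \in [seq h.2 | h : hook <- H].

Lemma open_hooksP (j d : nat) :
  reflect (exists2 h : hook, h \in H & h.1 = d /\ h.1 < j <= h.2) (d \in
    open_hooks j).
Proof.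
rewrite mem_rev; apply: (iffP mapP) => [[h]|[h hH [<- hj]]].
  by rewrite mem_filter => /andP[hj hH] ->; exists h.
by exists h; rewrite // mem_filter hj.
Qed.

Lemma open_hooks_sorted (j : nat) : sorted gtn (open_hooks j).
Proof.
rewrite rev_sorted; apply: (subseq_sorted ltn_trans) (descents_sorted p).
by have [_ <- _ _] := lamH; apply/map_subseq/filter_subseq.
Qed.

Lemma gtn_sorted_cons (d : nat) (S : seq nat) :
  sorted gtn (d :: S) -> sorted gtn S /\ forall x, x \in S -> x < d.
Proof.
rewrite /= (path_sortedE (rev_trans ltn_trans)) => /andP[/allP h ->].
by split=> // x /h.
Qed.

(** A hook opened after [h] and still open at [j] would, by laminarity, end strictly before [j]. *)
Lemma open_hooks_top (j : nat) (h : hook) : h \in H -> h.2 = j ->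
  exists2 S, open_hooks j = h.1 :: S & forall d, d \in S -> d < h.1.
Proof.
move=> hH hj; have [hkH _ _ lH] := lamH.
have /and3P[h12 _ _] := allP hkH h hH.
have : h.1 \in open_hooks j by apply/open_hooksP; exists h;
  rewrite // -hj h12 leqnn.
case eO : (open_hooks j) => [|d S] //=; have := open_hooks_sorted j.
rewrite eO => /gtn_sorted_cons[_ ltS]; rewrite inE => /orP[/eqP e|/ltS lt].
  by exists S; rewrite e.
have /open_hooksP[g gH [gd /andP[gj jg]]] : d \in open_hooks j
  by rewrite eO mem_head.
rewrite -gd in lt.
by have [] := lH h g hH gH lt; rewrite hj ?(leqNgt j) ?gj // ltnNge jg.
Qed.

Lemma step_open_hooks (j : nat) :
  step p j (open_hooks j) (northeast j) = open_hooks j.+1.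
Proof.
have [hkH dH _ lH] := lamH.
set T := if northeast j then behead (open_hooks j) else open_hooks j.
have sO := open_hooks_sorted j.
have sT : sorted gtn T.
  rewrite /T; case: ifP => // _; case: (open_hooks j) sO => //= d S.
  exact: path_sorted.
have memT d : d \in T <-> exists2 h : hook, h \in H & h.1 = d /\ h.1 < j < h.2.
  rewrite /T /northeast; case: ifPn => [/mapP[h hH hj]|/negP nj]; last first.
    split=> [/open_hooksP|] [g gH [gd /andP[gj jg]]]; last first.
      by apply/open_hooksP; exists g; rewrite // gj (ltnW jg).
    exists g => //; rewrite gj ltn_neqAle jg andbT; split=> //.
    by apply/eqP => e; apply: nj; rewrite e map_f.
  have [S eO ltS] := open_hooks_top hH (esym hj); rewrite eO /=.
  split=> [dS|[g gH [gd /andP[gj jg]]]].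
    have /open_hooksP[g gH [gd /andP[gj jg]]] : d \in open_hooks j.
      by rewrite eO inE dS orbT.
    exists g => //; rewrite gj /=; split=> //.
    have lt := ltS _ dS; rewrite -gd in lt.
    have /and3P[h12 _ _] := allP hkH h hH.
    by have [] := lH g h gH hH lt => ?; lia.
  have : d \in open_hooks j.
    by apply/open_hooksP; exists g; rewrite // gj (ltnW jg).
  rewrite eO inE => /orP[/eqP e|//].
  have us : uniq [seq h.1 | h : hook <- H] by rewrite dH descents_uniq.
  have eg : g = h by apply: uniq_map_inj us gH hH _; rewrite gd e.
  by rewrite eg -hj ltnn in jg.
have ltT d : d \in T -> d < j by case/memT => g _ [<- /andP[]].
(* Both stacks are strictly decreasing, so comparing their members suffices. *)
rewrite /step -/T; apply: (irr_sorted_eq (leT := gtn)).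
- exact: rev_trans ltn_trans.
- exact: ltnn.
- rewrite /push; case: ifP =>
    //= _; rewrite (path_sortedE (rev_trans ltn_trans)).
  by rewrite sT andbT; apply/allP => d /ltT.
- exact: open_hooks_sorted.
move=> d; apply/idP/open_hooksP => [|[h hH [hd /andP[hj jh]]]].
  have push_mem : d \in push p j T ->
    (d \in T) || (d == j) && (j \in descents p).
    by rewrite /push; case: ifP => _; rewrite ?inE ?andbT ?andbF ?orbF // orbC.
  case/push_mem/orP => [/memT[h hH [hd /andP[hj jh]]]|/andP[/eqP -> jd]].
    by exists h => //; rewrite ltnS (ltnW hj) jh.
  rewrite -dH in jd; case/mapP: jd => h hH hj; exists h => //;
    rewrite hj ltnS leqnn.
  by have /and3P[-> _ _] := allP hkH h hH.
rewrite /push; move: hj; rewrite ltnS leq_eqVlt => /orP[/eqP e|hj].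
  by rewrite -hd e -dH -e map_f // mem_head.
have dT : d \in T by apply/memT; exists h => //; rewrite hj.
by case: ifP => _; rewrite ?inE dT ?orbT.
Qed.

Lemma closable_open_hooks (j : nat) : northeast j ->
  closable p j (open_hooks j).
Proof.
case/mapP => h hH ->; have [S -> _] := open_hooks_top hH (erefl _).
by have [/allP/(_ h hH)/and3P[]] := lamH.
Qed.

Lemma laminar_scan (k j : nat) :
  let bs := [seq northeast i | i <- iota j k] in
  [/\ valid_scan p j (open_hooks j) bs,
      scan p j (open_hooks j) bs = open_hooks (j + k) &
      colors p 0 j (open_hooks j) bs =
      [seq top_color 0 (open_hooks i) | i <- iota j k & ~~ northeast i]].
Proof.
elim: k j => [|k IH] j /=; first by rewrite addn0.
rewrite step_open_hooks; have [-> -> ->] := IH j.+1; rewrite andbT addSnnS.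
split=> //; first exact/implyP/closable_open_hooks.
by case: (northeast j).
Qed.

Lemma open_hooks0 : open_hooks 0 = [::].
Proof. by rewrite /open_hooks; elim: (H). Qed.

Lemma open_hooks_size : open_hooks (size p) = [::].
Proof.
case eO: (open_hooks _) => [|d S] //.
have /open_hooksP[h hH [_ /andP[_]]] : d \in open_hooks (size p).
  by rewrite eO mem_head.
by have [/allP/(_ h hH)/and3P[_]] := lamH; rewrite ltnNge => /negP.
Qed.

(** No point lies directly above a hook and entries are distinct, so the height condition is
    automatic away from northeast endpoints. *)
Lemma belowE (h : hook) (m : nat) : h \in H -> m < size p -> ~~ northeast m ->
  below p m h = (h.1 < m <= h.2).
Proof.
move=> hH mp nm; rewrite /below; have [hk _ aH _] := lamH.
have /and3P[_ hp _] := allP hk h hH.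
have nh : m <> h.2 by move=> e; move: nm; rewrite e /northeast map_f.
rewrite [m <= _]leq_eqVlt (introF eqP nh) /=.
case lt : (_ < m < _) => //=.
have := aH h m hH; rewrite /directly_above lt /= -leqNgt leq_eqVlt.
by case/orP => // /eqP /(entry_eq up mp hp).
Qed.

(** Hooks open at [m] are nested, and an inner one is lower because its northeast endpoint is not
    directly above the outer one. The lowest hook is thus the top of the stack. *)
Lemma has_colorE (m c : nat) : m < size p -> ~~ northeast m -> c <= ndes p ->
  has_color p H m c =
  (top_color 0 (open_hooks m) == nth 0 (0 :: [seq d.+1 | d <- descents p]) c).
Proof.
move=> mp nm; have [hk dH aH lH] := lamH.
case: c => [|c] cn /=.
  case eO : (open_hooks m) => [|d S] /=.
    apply/hasPn => h hH; rewrite belowE //; apply/negP => hm.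
    have : h.1 \in open_hooks m by apply/open_hooksP; exists h.
    by rewrite eO.
  apply/negPn/hasP; have /open_hooksP[h hH [_ hm]] : d \in open_hooks m.
    by rewrite eO mem_head.
  by exists h => //; rewrite belowE.
have sH : size H = ndes p by rewrite /ndes -dH size_map.
rewrite sH cn (nth_map 0) // -dH (nth_map (0, 0)) ?sH //=.
have : nth (0, 0) H c \in H by rewrite mem_nth ?sH.
set h := nth _ H c => hH; rewrite belowE //.
have us : uniq [seq h.1 | h : hook <- H] by rewrite dH descents_uniq.
case eO : (open_hooks m) => [|d S] /=.
  apply/negbTE/negP => /andP[hm _].
  have : h.1 \in open_hooks m by apply/open_hooksP; exists h.
  by rewrite eO.
have /open_hooksP[g gH [gd gm]] : d \in open_hooks m by rewrite eO mem_head.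
have := open_hooks_sorted m; rewrite eO => /gtn_sorted_cons[_ ltS].
rewrite eqSS -gd; apply/andP/eqP => [[hm /allP/(_ g gH)]|e].
  rewrite belowE // gm /= => le.
  have : h.1 \in open_hooks m by apply/open_hooksP; exists h.
  rewrite eO inE => /orP[/eqP -> //|/ltS]; rewrite -gd => lt.
  have [?|lt2] := lH h g hH gH lt; first by lia.
  have /and3P[_ gp _] := allP hk g gH; have /and3P[_ hp _] := allP hk h hH.
  have := aH h g.2 hH; rewrite /directly_above lt2 andbT.
  have -> : h.1 < g.2 by lia.
  rewrite /= -leqNgt leq_eqVlt ltnNge le orbF => /eqP /(entry_eq up gp hp) e.
  by rewrite e ltnn in lt2.
have eg : g = h by apply: uniq_map_inj us gH hH e.
rewrite -eg; split=> //; apply/allP => f fH; rewrite belowE //;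
  apply/implyP => fm.
have : f.1 \in open_hooks m by apply/open_hooksP; exists f.
rewrite eO inE => /orP[/eqP ef|/ltS].
  have -> // : f = g by apply: uniq_map_inj us fH gH _; rewrite ef gd.
rewrite -gd => lt; have [?|lt2] := lH f g fH gH lt; first by lia.
have := aH f g.2 fH; rewrite /directly_above lt2 andbT.
have -> : f.1 < g.2 by lia.
by rewrite -leqNgt.
Qed.

Lemma color_count_scan (c : nat) : c <= ndes p ->
  color_count p H c =
  count_mem (nth 0 (0 :: [seq d.+1 | d <- descents p]) c)
    (colors p 0 0 [::] [seq northeast i | i <- iota 0 (size p)]).
Proof.
move=> cn; have [_ _] := laminar_scan (size p) 0; rewrite open_hooks0 => ->.
rewrite count_map count_filter; apply: eq_in_count => m.
rewrite mem_iota add0n /= => mp; rewrite andbC /northeast.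
by case nm : (m \in _) =>
  //=; rewrite ?andbF // !andbT has_colorE // /northeast nm.
Qed.

End LaminarScan.

(** * From scans to valid hook configurations *)

Section ClosedHooks.
Variable p : seq nat.

Fixpoint closed_hooks (j : nat) (S : seq nat) (bs : seq bool) : seq hook :=
  if bs is b :: bs' then
    nseq b (head 0 S, j) ++ closed_hooks j.+1 (step p j S b) bs'
  else [::].

(** Every hook opened is either closed or still open at the end; with empty stacks at both ends, the
    southwest endpoints are exactly the descents. *)
Lemma perm_closed_hooks (j : nat) (S : seq nat) (bs : seq bool) :
  valid_scan p j S bs ->
  perm_eq ([seq h.1 | h : hook <- closed_hooks j S bs] ++ scan p j S bs)
          (S ++ [seq d <- iota j (size bs) | d \in descents p]).
Proof.
elim: bs j S => [|b bs IH] j S /=; first by rewrite cats0.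
case/andP => cl /IH pc; rewrite map_cat -catA.
have eP X Y : perm_eq (push p j X ++ Y)
    (X ++ (if j \in descents p then j :: Y else Y)).
  by rewrite /push; case: ifP =>
    //= _; rewrite -(cat1s j Y) perm_sym perm_catCA.
case: b cl pc => /= [|_] pc; last exact: perm_trans pc (eP S _).
case: S pc => //= d S _ pc; rewrite perm_cons.
exact: perm_trans pc (eP S _).
Qed.

Lemma mem_closed_hooks (j : nat) (S : seq nat) (bs : seq bool) (h : hook) :
  valid_scan p j S bs -> h \in closed_hooks j S bs ->
  [/\ j <= h.2 < j + size bs, entry p h.1 < entry p h.2 &
      (h.1 \in S) || (j <= h.1 < h.2)].
Proof.
elim: bs j S => //= b bs IH j S /andP[cl vs]; rewrite mem_cat mem_nseq.
case/orP => [/andP[b0 /eqP ->]|/(IH _ _ vs) [/andP[jh hj] lt hS]] /=.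
  case: b b0 cl {vs} => // _; case: S => //= d S lt.
  by rewrite leqnn -addn1 leq_add2l lt mem_head.
rewrite addnS hj ltnW //; split=> //.
case/orP: hS => [|/andP[/ltnW -> ->]]; last by rewrite orbT.
rewrite /step /push; set S' := if b then _ else _.
have sS' : {subset S' <= S} by rewrite /S'; case: b {cl vs S'} => //;
  case: S => // d S x xS; rewrite inE xS orbT.
case: ifP => _; last by move/sS' ->.
by rewrite inE => /orP[/eqP ->|/sS' -> //]; rewrite leqnn jh orbT.
Qed.

Lemma closed_hooks_northeast (j : nat) (S : seq nat) (bs : seq bool) :
  valid_scan p j S bs ->
  bs = [seq northeast (closed_hooks j S bs) i | i <- iota j (size bs)].
Proof.
elim: bs j S => //= b bs IH j S /andP[_ vs]; rewrite /northeast; congr (_ :: _).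
  rewrite map_cat mem_cat; apply/esym.
  have -> : (j \in [seq h.2 | h : hook <- closed_hooks j.+1 (step p j S b) bs])
    = false.
    by apply/mapP => -[h /(mem_closed_hooks vs) [/andP[jh _] _ _] e];
      rewrite e ltnn in jh.
  by case: b {vs}; rewrite ?mem_head.
rewrite {1}(IH _ _ vs); apply/eq_in_map => i; rewrite mem_iota => /andP[ji _].
rewrite /northeast map_cat mem_cat; case: b {vs} => //=.
by rewrite inE gtn_eqF.
Qed.

(** The stack decreases from the top, so once [g] is closed at [j], a hook with larger southwest
    endpoint cannot come from the rest of the stack: it starts at [j] or later. *)
Lemma closed_hooks_laminar (j : nat) (S : seq nat) (bs : seq bool) (g h : hook)
  :
  valid_scan p j S bs -> sorted gtn S -> all (fun d => d < j) S ->
  g \in closed_hooks j S bs -> h \in closed_hooks j S bs ->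
  g.1 < h.1 -> g.2 <= h.1 \/ h.2 < g.2.
Proof.
elim: bs j S => //= b bs IH j S /andP[cl vs] sS aS; rewrite !mem_cat !mem_nseq.
have sP : sorted gtn (step p j S b) /\ all (fun d => d < j.+1) (step p j S b).
  rewrite /step /push; set S' := if b then _ else _.
  have [sS' aS'] : sorted gtn S' /\ all (fun d => d < j) S'.
    rewrite /S'; case: b {cl vs S'} => //; case: S sS aS => //= d S.
    by rewrite (path_sortedE (rev_trans ltn_trans)) => /andP[_ ->] /andP[].
  have aS1 : all (fun d => d < j.+1) S' by apply: sub_all aS' => d /ltnW.
  case: ifP => // _; rewrite /= ltnSn aS1; split=> //.
  by rewrite (path_sortedE (rev_trans ltn_trans)) aS'.
case/orP => [/andP[b0 /eqP ->]|gC] /orP[/andP[b1 /eqP ->]|hC] //=.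
- by rewrite ltnn.
- have [_ _ hS] := mem_closed_hooks vs hC; move=> lt; left.
  have {}b0 : b by case: (b) b0.
  case/orP: hS => [|/andP[/ltnW //]]; rewrite /step b0 /push.
  have SC : h.1 \in behead S -> False.
    case: S sS lt {cl vs aS sP hC} => //= d S;
      rewrite (path_sortedE (rev_trans ltn_trans)).
    by move=> /andP[/allP aS _] lt /aS; rewrite ltnNge ltnW.
  by case: ifP => _; [rewrite inE => /orP[/eqP ->|/SC]|move/SC].
- by have [/andP[]] := mem_closed_hooks vs gC; right.
by case: sP => s1 s2; apply: IH vs s1 s2 gC hC.
Qed.

(* Between an open descent and the current position, the current entry is the
   largest, and likewise between consecutive open descents. *)
Fixpoint covered (x : nat) (S : seq nat) : Prop :=
  if S is d :: S' then
    (forall m, d < m <= x -> entry p m <= entry p x) /\ covered d S'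
  else True.

Lemma covered_behead (x : nat) (S : seq nat) :
  closable p x S -> covered x S -> covered x (behead S).
Proof.
case: S => //= d [|d' S] //= lt [cx [cd cS]]; split=> // m /andP[dm mx].
case: (leqP m d) => md; last by apply: cx; rewrite md.
by apply: leq_trans (ltnW lt); apply: cd; rewrite dm.
Qed.

Lemma covered_step (j : nat) (S : seq nat) (b : bool) : uniq p ->
  j.+1 < size p -> (b ==> closable p j S) -> covered j S ->
  covered j.+1 (step p j S b).
Proof.
move=> up jp cl cS; rewrite /step; set S' := if b then _ else _.
have {cS} : covered j S'.
  by rewrite /S'; case: b cl {S'} => //= cl; apply: covered_behead.
rewrite /push; case: ifPn => [_ cS' /=|jd].
  by split=> // m mj; have -> : m = j.+1 by lia.
case: S' => //= d S2 [cj cS2]; split=> // m /andP[dm].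
rewrite leq_eqVlt => /orP[/eqP -> //|mj].
by apply: leq_trans (ltnW (notin_descents up jp jd)); apply: cj; rewrite dm.
Qed.

Lemma closed_hooks_above (j : nat) (S : seq nat) (bs : seq bool) (h : hook) (m
  : nat) :
  uniq p -> j + size bs <= size p -> valid_scan p j S bs -> covered j S ->
  h \in closed_hooks j S bs -> h.1 < m < h.2 -> entry p m <= entry p h.2.
Proof.
move=> up; elim: bs j S => //= b bs IH j S jp /andP[cl vs] cS.
rewrite mem_cat mem_nseq => /orP[/andP[b0 /eqP ->]|hC].
  have {}b0 : b by case: (b) b0.
  rewrite b0 in cl; case: S cl cS {vs} => //= d S _ [cj _] /andP[dm mj].
  by apply: cj; rewrite dm ltnW.
case: bs IH jp vs hC => [|b' bs] // IH jp vs hC.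
apply: IH vs _ hC; first by rewrite addSnnS.
by apply: covered_step => //; rewrite /= in jp; lia.
Qed.

Lemma scan_laminar (bs : seq bool) : uniq p -> size bs = size p ->
  valid_scan p 0 [::] bs -> scan p 0 [::] bs = [::] ->
  exists2 H, laminar p H & bs = [seq northeast H i | i <- iota 0 (size p)].
Proof.
move=> up sz vs sc; set C := closed_hooks 0 [::] bs.
(* A scan emits hooks by northeast endpoint, while a configuration lists them by southwest
   endpoint. *)
set H := sort (fun g h : hook => g.1 <= h.1) C.
have memH h : (h \in H) = (h \in C) by rewrite mem_sort.
have mC (h : hook) : h \in C ->
  [/\ h.1 < h.2, h.2 < size p & entry p h.1 < entry p h.2].
  by move/(mem_closed_hooks vs); rewrite sz add0n /= => -[].
exists H; last first.
  rewrite {1}(closed_hooks_northeast vs) sz; apply: eq_map => i.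
  by rewrite /northeast; apply: perm_mem; apply: perm_map;
    rewrite perm_sym perm_sort.
split.
- by apply/allP => h; rewrite memH => /mC[? ? ?]; apply/and3P.
- rewrite /H -sort_map -[RHS](sorted_sort leq_trans).
    apply/(perm_sortP leq_total leq_trans anti_leq).
    have := perm_closed_hooks vs; rewrite sc cats0 sz /= => pc.
    apply: perm_trans pc _; apply: uniq_perm.
    - by rewrite filter_uniq ?iota_uniq.
    - exact: descents_uniq.
    move=> d; rewrite mem_filter mem_iota /= add0n mem_descents.
    by case: (ltnP d.+1 (size p)) => //= /ltnW ->; rewrite andbT.
  by apply: sub_sorted (descents_sorted p) => x y /ltnW.
- move=> h m; rewrite memH => hC; apply/negP => /andP[hm].
  by rewrite ltnNge (closed_hooks_above up _ vs _ hC hm) ?sz.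
move=> g h; rewrite !memH.
exact: (closed_hooks_laminar vs).
Qed.

End ClosedHooks.

(** * The canonical hook configuration *)

(** Inorder listing puts the southwest endpoints in increasing order, as in [canonical]. *)
Fixpoint tree_hooks (t : ptree) : seq hook :=
  match t with
  | PLeaf _ => [::]
  | POne t => tree_hooks t
  | PTwo l r => tree_hooks l ++ (root l, (root r).+1) :: tree_hooks r
  end.

Section Canonical.
Variable p : seq nat.

Lemma mem_tree_hooks (t : ptree) (h : hook) : canonical_tree p t ->
  h \in tree_hooks t -> [/\ first t <= h.1, h.1 < h.2 & h.2 <= root t].
Proof.
elim: t => //= [t IH /andP[wt _] /(IH wt) [? ? ?]|l IHl r IHr].
  by split=> //; apply: leqW.
case/and5P => wl wr /eqP e _ _; have fl := first_root wl;
  have fr := first_root wr.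
rewrite mem_cat inE => /or3P[/(IHl wl) [? ? ?]|/eqP -> /=|/(IHr wr) [? ? ?]];
  by split=> //; lia.
Qed.

(** At a binary vertex, everything right of [root l] is weakly below the hook of that vertex. As
    [spine r] is below [root l], the subtree [r] offers no endpoint for the hook from [root l]. *)
Lemma uncovered_le_spine (t : ptree) (j : nat) : canonical_tree p t ->
  first t <= j <= root t -> all (fun h =>
    ~~ weakly_below p j h) (tree_hooks t) ->
  entry p j <= spine p t.
Proof.
elim: t => /= [a _|t IH w|l IHl r IHr w].
- by rewrite -eqn_leq => /eqP ->.
- by move=> tj _; exact: (root_max (t := POne t)).
move: (w); case/and5P => wl wr /eqP e s1 /andP[lt1 lt2] /andP[fj jr].
rewrite all_cat /= => /and3P[al + _]; rewrite /weakly_below /below /=.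
case: (leqP j (root l)) => jl; first by move=> _; apply: IHl => //; rewrite fj.
case: (eqVneq j (root r).+1) => [_|nj] /=; first by rewrite orbT.
have jr' : j <= root r by lia.
rewrite ltnS jr' /= (leq_ltn_trans (root_max wr _) lt2) //.
by rewrite e jl.
Qed.

Lemma head_sort_min (f : nat -> nat) (s : seq nat) (x : nat) :
  x \in s -> (forall y, y \in s -> y != x -> f x < f y) ->
  head 0 (sort (fun i j => f i <= f j) s) = x.
Proof.
move=> xs min_x; have : x \in sort (fun i j => f i <= f j) s
  by rewrite mem_sort.
have tr : transitive (fun i j => f i <= f j) by move=> ? ? ?; apply: leq_trans.
have := sort_sorted (fun i j => leq_total (f i) (f j)) s.
case eS : (sort _ s) => [|y S] //= /(order_path_min tr) /allP ay.
rewrite inE => /orP[/eqP -> //|/ay le]; apply: contraTeq le => ny.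
by rewrite -ltnNge min_x // -(mem_sort (fun i j => f i <= f j)) eS mem_head.
Qed.

(** The descents of [t] are processed from right to left, after the later hooks [Hs]. The hypothesis
    on positions beyond the root keeps each search inside [t]. *)
Lemma canonical_tree_hooks (t : ptree) (Hs : seq hook) : uniq p ->
    canonical_tree p t -> root t < size p ->
    (forall h : hook, h \in Hs -> root t <= h.1 < h.2) ->
    (forall j, root t < j < size p ->
       all (fun h => ~~ weakly_below p j h) Hs ->
         entry p (root t) < entry p j) ->
  foldr (fun d Hs => (d, canonical_ne p d Hs) :: Hs) Hs (ptree_descents p t) =
  tree_hooks t ++ Hs.
Proof.
move=> up; elim: t Hs => [a|t IH|l IHl r IHr] Hs.
- by rewrite /ptree_descents /= subnn.
- move=> w tp H1 H2; rewrite ptree_descents_one //; case/andP: w => wt lt.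
  apply: IH => //; first exact: ltnW.
    by move=> h /H1 /andP[/ltnW -> ->].
  move=> j /andP[tj jp] aj; case: (eqVneq j (root t).+1) => [-> //|nj].
  by apply: ltn_trans lt (H2 j _ aj); rewrite /= jp andbT; lia.
move=> w; have /= w' := w; rewrite ptree_descents_two //.
case/and5P: w' => wl wr /eqP e s1 /andP[lt1 lt2] /= rp H1 H2.
have fl := first_root wl; have fr := first_root wr.
rewrite foldr_cat /= (IHr Hs) //=; first last.
- move=> j /andP[tj jp] aj; case: (eqVneq j (root r).+1) => [-> //|nj].
  by apply: ltn_trans lt2 (H2 j _ aj); rewrite jp andbT; lia.
- by move=> h /H1 /andP[/ltnW -> ->].
- exact: ltnW.
(* Uncovered positions of [r] are too low, and those beyond the root are higher than the root, which
   is therefore the lowest candidate. *)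
have -> : canonical_ne p (root l) (tree_hooks r ++ Hs) = (root r).+1.
  apply: head_sort_min => [|y].
    rewrite mem_filter mem_iota rp lt1 /= andbT all_cat.
    apply/and3P; split; first by lia.
      apply/allP => h /(mem_tree_hooks wr) [h1 h2 h3].
      by rewrite /weakly_below /below; apply/norP; split; lia.
    apply/allP => h /H1 /andP[h1 h2]; rewrite /weakly_below /below.
    by apply/norP; split; lia.
  rewrite mem_filter mem_iota /= all_cat => /andP[/and4P[dy py ar aH] yp] ny.
  case: (ltnP y (root r).+1) => yr.
    have := leq_ltn_trans (uncovered_le_spine wr _ ar) s1.
    by rewrite e dy -ltnS yr => /(_ isT) /ltn_trans/(_ py); rewrite ltnn.
  by apply: H2 => //; rewrite yp andbT; lia.
rewrite (IHl ((root l, (root r).+1) :: tree_hooks r ++ Hs)) //;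
  first by rewrite -catA.
- by lia.
- move=> h; rewrite inE mem_cat =>
    /or3P[/eqP -> /=|/(mem_tree_hooks wr) []|/H1 /andP[]] *; lia.
move=> j /andP[lj jp] /= /andP[nw]; rewrite all_cat => /andP[_ aH].
case: (ltngtP j (root r).+1) nw => [jr|jr _|->];
  last by rewrite /weakly_below eqxx orbT.
  rewrite /weakly_below /below /= lj jr /= => /norP[/negP[]].
  by apply: leq_ltn_trans lt2; apply: root_max => //; rewrite e lj.
by apply: ltn_trans lt1 _; apply: H2; rewrite ?jr.
Qed.

Lemma canonical_eq_tree_hooks (t : ptree) : uniq p -> canonical_tree p t ->
  first t = 0 -> (root t).+1 = size p -> canonical p = tree_hooks t.
Proof.
move=> up wt t0 tn; rewrite -[RHS]cats0 -canonical_tree_hooks -?tn //.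
  by rewrite /canonical /ptree_descents t0 subn0 /descents -tn.
by move=> j /andP[? ?]; lia.
Qed.

Fixpoint btree_of (t : ptree) : btree :=
  match t with
  | PLeaf a => Node Empty (entry p a) Empty
  | POne t => Node Empty (entry p (root t).+1) (btree_of t)
  | PTwo l r => Node (btree_of l) (entry p (root r).+1) (btree_of r)
  end.

Lemma tree_hooks_ending (t : ptree) (j : nat) : canonical_tree p t ->
  ~~ (first t < j <= root t) -> [seq h <- tree_hooks t | h.2 == j] = [::].
Proof.
move=> wt nj; apply/eqP; rewrite -size_eq0 size_filter -leqn0 leqNgt -has_count.
by apply/hasP => -[h /(mem_tree_hooks wt) [h1 h2 h3] /eqP e]; move: nj;
   rewrite -e h3 (leq_ltn_trans h1 h2).
Qed.

(** A leaf is at position 0 or follows a descent, so it gets no right child. The hypothesis on [H]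
    lets the hooks of a larger tree stand in for those of a subtree. *)
Lemma Theta_at_btree_of (H : seq hook) (t : ptree) (fuel : nat) :
    canonical_tree p t -> root t < size p -> root t < fuel ->
    (first t == 0) || ((first t).-1 \in descents p) ->
    (forall j, first t <= j <= root t ->
       [seq h <- H | h.2 == j] = [seq h <- tree_hooks t | h.2 == j]) ->
  Theta_at p H fuel (root t) = btree_of t.
Proof.
elim: t fuel => [a|t IH|l IHl r IHr] [|fuel] // wt tp tf df hj.
- rewrite /= hj ?leqnn //=; congr Node.
  by case: a df {tp tf hj wt} => //= a ->.
- rewrite [LHS]/= hj ?leqnn ?andbT ?(first_root wt) //;
    move: (wt) => /= /andP[wt' lt].
  rewrite tree_hooks_ending // ?ltnn ?andbF // (negPf (ascent_notin lt)).
  rewrite IH //; first exact: ltnW.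
  by move=> j /andP[j1 j2]; rewrite hj //= j1 leqW.
have dl := canonical_descent wt.
rewrite [LHS]/= hj ?leqnn ?andbT ?(first_root wt) //; move: (wt) => /=.
case/and5P => wl wr /eqP e s1 /andP[lt1 lt2] /=; rewrite /= in tp tf df hj.
have fl := first_root wl; have fr := first_root wr.
rewrite filter_cat /= eqxx tree_hooks_ending //; last by lia.
rewrite /= (negPf (ascent_notin lt2)) IHl ?IHr //.
- exact: ltnW.
- by rewrite e /= mem_descents dl andbT; lia.
- move=> j /andP[j1 j2]; rewrite hj; last by lia.
  rewrite filter_cat /= tree_hooks_ending //; last by lia.
  by rewrite gtn_eqF.
- by lia.
- by lia.
move=> j /andP[j1 j2]; rewrite hj; last by lia.
rewrite filter_cat /= [X in _ ++ X](_ : _ = [::]) ?cats0 // gtn_eqF;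
  last by lia.
by rewrite tree_hooks_ending //; lia.
Qed.

Lemma Theta_canonical (t : ptree) : uniq p -> canonical_tree p t ->
  first t = 0 -> (root t).+1 = size p -> Theta p (canonical p) = btree_of t.
Proof.
move=> up wt t0 tn; rewrite (canonical_eq_tree_hooks up wt t0 tn) /Theta -tn.
by apply: Theta_at_btree_of; rewrite -?tn ?t0.
Qed.

End Canonical.

(** * Contraction of the canonical tree *)

Fixpoint hat_tree (t : ptree) : btree :=
  match t with
  | PLeaf _ => Node Empty 1 Empty
  | POne t => if hat_tree t is Node l b r then Node l b.+1 r else Empty
  | PTwo l r => Node (hat_tree l) 0 (hat_tree r)
  end.

Lemma hat_tree_shape (t : ptree) :
  exists l b r, hat_tree t = Node l b r /\ is_empty l = is_empty r.
Proof.
elim: t => /= [_|t [l [b [r [-> e]]]]|t1 [l1 [b1 [r1 [-> e1]]]] t2 [l2 [b2 [r2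
  [-> e2]]]]].
- by exists Empty, 1, Empty.
- by exists l, b.+1, r.
by do 3 eexists; split.
Qed.

(** A contracted subtree has a root with 0 or 2 children, so each unary vertex merges into its
    child. A label thus counts the original vertices without left child that have a given leaf
    set. *)
Lemma hat_btree_of (p : seq nat) (t : ptree) :
  hat (init_labels (btree_of p t)) = hat_tree t.
Proof.
have ne u : is_empty (btree_of p u) = false by case: u.
elim: t => //= [t ->|l IHl r IHr].
  by rewrite ne /=; have [l [b [r [-> /= ->]]]] := hat_tree_shape t;
    rewrite eqxx.
rewrite IHl IHr !ne /=.
by have [l1 [b1 [r1 [-> _]]]] := hat_tree_shape l; case: (hat_tree r).
Qed.

(** * The vertices of the contracted tree *)

Definition block (m o k : nat) : {set 'I_m} := [set i : 'I_m | o <= i < o + k].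

Lemma size_leaves_gt0 (t : ptree) : 0 < size (leaves t).
Proof. by elim: t => //= l IHl r _; rewrite size_cat addn_gt0 IHl. Qed.

Lemma size_leaves_two (l r : ptree) :
  size (leaves (PTwo l r)) = size (leaves l) + size (leaves r).
Proof. exact: size_cat. Qed.

Lemma nleaves_hat_tree (t : ptree) : nleaves (hat_tree t) = size (leaves t).
Proof.
elim: t => //= [t <-|l IHl r IHr].
  by have [l [b [r [-> _]]]] := hat_tree_shape t.
rewrite size_cat -IHl -IHr.
by have [l1 [b1 [r1 [-> _]]]] := hat_tree_shape l.
Qed.

Lemma leafset_hat_tree (m o : nat) (t : ptree) :
  leafset m o (hat_tree t) = block m o (size (leaves t)).
Proof.
elim: t o => [a|t IH|l IHl r IHr] o.
- by apply/setP => i; rewrite !inE /=; lia.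
- by rewrite -IH /=; have [l [b [r [-> _]]]] := hat_tree_shape t.
have -> : leafset m o (hat_tree (PTwo l r)) =
    leafset m o (hat_tree l) :|: leafset m (o + nleaves (hat_tree l)) (hat_tree
      r).
  by rewrite /=; have [l1 [b1 [r1 [-> _]]]] := hat_tree_shape l.
rewrite IHl IHr nleaves_hat_tree size_leaves_two; apply/setP => i;
  rewrite !inE /=; lia.
Qed.

Lemma block_neq0 (m o k : nat) : 0 < k -> o + k <= m ->
  block m o k != finset.set0.
Proof.
move=> k0 okm; have om : o < m by lia.
by apply/finset.set0Pn; exists (Ordinal om); rewrite inE /=; lia.
Qed.

Lemma vertices_hat_tree_one (m o : nat) (t : ptree) :
  exists a s, vertices m o (hat_tree t) = (block m o (size (leaves t)), a) :: s
    /\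
    vertices m o (hat_tree (POne t)) = (block m o (size (leaves t)), a.+1) :: s.
Proof.
have := leafset_hat_tree m o t; rewrite /=.
by have [l [b [r [-> _]]]] := hat_tree_shape t => e; do 2 eexists;
  rewrite /= -e.
Qed.

Lemma vertices_hat_tree_two (m o : nat) (l r : ptree) :
  vertices m o (hat_tree (PTwo l r)) =
  (block m o (size (leaves l) + size (leaves r)), 0) ::
    vertices m o (hat_tree l) ++ vertices m (o + size (leaves l)) (hat_tree r).
Proof.
have := leafset_hat_tree m o (PTwo l r); rewrite size_leaves_two /= => <-.
by rewrite nleaves_hat_tree.
Qed.

Lemma vertices_block (m o : nat) (t : ptree) (I : {set 'I_m}) :
  o + size (leaves t) <= m ->
    I \in [seq v.1 | v <- vertices m o (hat_tree t)] ->
  I != finset.set0 /\ I \subset block m o (size (leaves t)).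
Proof.
elim: t o => [a|t IH|l IHl r IHr] o om.
- rewrite /= inE => /eqP ->; have := leafset_hat_tree m o (PLeaf a);
    rewrite /= => ->.
  by split; rewrite ?subxx // block_neq0.
- have [a [s [e1 e2]]] := vertices_hat_tree_one m o t.
  by move: (IH o om); rewrite e1 e2.
rewrite vertices_hat_tree_two size_leaves_two /=.
rewrite size_leaves_two in om; have l0 := size_leaves_gt0 l.
rewrite inE map_cat mem_cat => /or3P[/eqP ->|/IHl h|/IHr h].
- by split; [apply: block_neq0; lia|exact: subxx].
- have [|-> sb] := h; first by lia.
  split=> //; apply: fintype.subset_trans sb _; apply/fintype.subsetP => i;
    rewrite !inE /=; lia.
have [|-> sb] := h; first by lia.
split=> //; apply: fintype.subset_trans sb _; apply/fintype.subsetP => i;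
  rewrite !inE /=; lia.
Qed.

(** Siblings have disjoint nonempty blocks, both properly contained in that of the parent. Hence
    [ylabel] reads off the label of a vertex unambiguously. *)
Lemma vertices_uniq (m o : nat) (t : ptree) : o + size (leaves t) <= m ->
  uniq [seq v.1 | v <- vertices m o (hat_tree t)].
Proof.
elim: t o => [a|t IH|l IHl r IHr] o om //.
  have [a [s [e1 e2]]] := vertices_hat_tree_one m o t.
  by move: (IH o om); rewrite e1 e2.
rewrite size_leaves_two in om.
have l0 := size_leaves_gt0 l; have r0 := size_leaves_gt0 r.
have oml : o + size (leaves l) <= m by lia.
have omr : o + size (leaves l) + size (leaves r) <= m by lia.
rewrite vertices_hat_tree_two /= map_cat cat_uniq IHl // IHr // andbT mem_cat.
have om1 : o < m by lia.
have om2 : o + size (leaves l) < m by lia.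
apply/andP; split; last first.
  apply/hasPn => I /(vertices_block omr) [/finset.set0Pn[i Ii] /fintype.subsetP
    sb].
  apply/negP => /(vertices_block oml) [_ /fintype.subsetP/(_ i Ii)].
  by have := sb i Ii; rewrite !inE /=; lia.
apply/negP => /orP[/(vertices_block oml)|/(vertices_block omr)] [_
  /fintype.subsetP].
  by move/(_ (Ordinal om2)); rewrite !inE /=; lia.
by move/(_ (Ordinal om1)); rewrite !inE /=; lia.
Qed.

(** * Minkowski sums of simplices along a tree *)

Section TreePolytope.
Local Open Scope classical_set_scope.
Local Open Scope ring_scope.
Variables (R : realType) (m : nat).

Fixpoint tree_polytope (o : nat) (t : ptree) : set 'rV[R]_m :=
  match t with
  | PLeaf _ => Delta R (block m o 1)
  | POne t => msum (Delta R (block m o (size (leaves t)))) (tree_polytope o t)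
  | PTwo l r => msum (tree_polytope o l) (tree_polytope (o + size (leaves l)) r)
  end.

(** By [dilate_succ], a label [a] stands for [a] summands with the same leaf set; a label 0
    contributes the neutral set because the simplex is nonempty. *)
Lemma vertices_msum (o : nat) (t : ptree) : (o + size (leaves t) <= m)%N ->
  \big[@msum R m/[set 0]]_(v <- vertices m o (hat_tree t))
    dilate v.2%:R (Delta R v.1) = tree_polytope o t.
Proof.
elim: t o => [a|t IH|l IHl r IHr] o om.
- have e := leafset_hat_tree m o (PLeaf a); rewrite /= in e *.
  rewrite e big_seq1 /= -[RHS](msum0s (Delta R (block m o 1))).
  rewrite (dilate_succ 0); last exact: conv_convex.
  by rewrite dilate0 //; apply/Delta_neq0/block_neq0.
- have [a [s [e1 e2]]] := vertices_hat_tree_one m o t.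
  move: (IH o om); rewrite e1 e2 !big_cons /= => <-.
  rewrite (dilate_succ a); last exact: conv_convex.
  by rewrite [msum (dilate _ _) _ in LHS]msumC msumA.
rewrite size_leaves_two in om.
have l0 := size_leaves_gt0 l.
rewrite vertices_hat_tree_two big_cons big_cat /= IHl; last by lia.
rewrite IHr; last by lia.
rewrite dilate0 ?msum0s //; apply/Delta_neq0/block_neq0; lia.
Qed.

End TreePolytope.

(** * The fertilitope *)

Section ColorVectors.
Local Open Scope classical_set_scope.
Local Open Scope ring_scope.
Variables (R : realType) (m : nat) (names : seq nat).
Hypotheses (uniq_names : uniq names) (size_names : size names = m).

Definition color_vector (cs : seq nat) : 'rV[R]_m :=
  \row_c (count_mem (nth 0%N names c) cs)%:R.

Lemma color_vector_perm (cs ds : seq nat) : perm_eq cs ds ->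
  color_vector cs = color_vector ds.
Proof. by move=> /permP pc; apply/rowP => i; rewrite !mxE pc. Qed.

Lemma color_vector_cat (cs ds : seq nat) :
  color_vector (cs ++ ds) = color_vector cs + color_vector ds.
Proof. by apply/rowP => i; rewrite !mxE count_cat natrD. Qed.

Lemma color_vector1 (i : 'I_m) : color_vector [:: nth 0%N names i] = delta_mx 0
  i.
Proof.
by apply/rowP => j; rewrite !mxE /= addn0 nth_uniq ?size_names // eq_sym.
Qed.

(** The choice made at a unary vertex ranges over the vertices of a simplex, and choices in
    different subtrees are independent, so [conv_msum] carries the hull through the recursion. *)
Lemma conv_color_vector (o : nat) (t : ptree) : (o + size (leaves t) <= m)%N ->
    (forall i, (i < size (leaves t))%N ->
       nth 0%N names (o + i) = nth 0%N (leaves t) i) ->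
  conv (color_vector @` [set cs | colorings t cs]) = @tree_polytope R m o t.
Proof.
elim: t o => [a|t IH|l IHl r IHr] o om nm.
- rewrite /= /Delta; congr conv; rewrite addn1 in om.
  have := nm 0%N isT; rewrite addn0 /= => oa.
  apply/seteqP; split => [_ [cs /color_vector_perm /= -> <-]|_ [i io ->]].
    exists (Ordinal om); first by rewrite inE /=; lia.
    by rewrite -oa -color_vector1.
  exists [:: a]; first exact: perm_refl.
  rewrite -color_vector1; congr (color_vector [:: _]); rewrite -oa; congr nth.
  by move: io; rewrite inE; lia.
- rewrite [RHS]/= -(IH o) // /Delta -conv_msum; congr conv.
  apply/seteqP; split => [_ [cs [c [ds [ct cds pc]]] <-]|].
    have ci : (o + index c (leaves t) < m)%N.
      by apply: leq_trans om; rewrite ltn_add2l index_mem.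
    exists (delta_mx 0 (Ordinal ci)).
      by exists (Ordinal ci) => //; rewrite inE /= leq_addr ltn_add2l index_mem.
    exists (color_vector ds); first by exists ds.
    rewrite (color_vector_perm pc) -cat1s color_vector_cat -color_vector1.
    by rewrite nm ?index_mem //= nth_index.
  move=> _ [_ [i ib ->] [_ [ds cds <-] <-]].
  exists (nth 0%N names i :: ds); last
    by rewrite -cat1s color_vector_cat color_vector1.
  exists (nth 0%N names i), ds; split=> //.
  move: ib; rewrite inE => /andP[oi io].
  have io' : (i - o < size (leaves t))%N by rewrite ltn_subLR.
  by rewrite -(subnKC oi) nm // mem_nth.
rewrite size_leaves_two in om nm.
rewrite [RHS]/= -(IHl o) => [|| i il]; first last.
- by rewrite nm /= ?nth_cat ?il //; lia.
- by lia.
rewrite -(IHr (o + size (leaves l))%N) => [|| i ir]; first last.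
- rewrite -addnA nm ?ltn_add2l //= nth_cat ltnNge leq_addr /=.
  by rewrite addKn.
- by lia.
rewrite -conv_msum.
congr conv; apply/seteqP; split => [_ [cs [ds [es [cds ces pc]]] <-]|].
  exists (color_vector ds); first by exists ds.
  exists (color_vector es); first by exists es.
  by rewrite (color_vector_perm pc) color_vector_cat.
move=> _ [_ [ds cds <-] [_ [es ces <-] <-]].
by exists (ds ++ es); [exists ds, es|rewrite color_vector_cat].
Qed.

End ColorVectors.

Section Fertilitope.
Local Open Scope classical_set_scope.
Local Open Scope ring_scope.

(** With no hook open at either end, [scan_colorings] leaves no surplus color, which gives one
    inclusion; [colorings_scan] followed by [scan_laminar] gives the other. *)
Lemma Vset_colorings (R : realType) (p : seq nat) (t : ptree) : uniq p ->
    canonical_tree p t -> first t = 0%N -> (root t).+1 = size p ->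
  Vset R p = color_vector R (ndes p).+1 (leaves t) @` [set cs | colorings t cs].
Proof.
move=> up wt t0 tn.
have eD : ptree_descents p t = descents p.
  by rewrite /ptree_descents t0 subn0 /descents -tn.
have eL : leaves t = 0%N :: [seq d.+1 | d <- descents p].
  by rewrite (leavesE wt) t0 eD.
have qE H : laminar p H -> qvec R p H = color_vector R (ndes p).+1 (leaves t)
    (colors p 0 0 [::] [seq northeast H i | i <- iota 0 (size p)]).
  move=> lH; apply/rowP => c; rewrite !mxE (color_count_scan up lH) ?eL //.
  by rewrite -ltnS.
have tp : (root t < size p)%N by rewrite -tn.
have push0 : push p (root t) [::] = [::].
  by rewrite /push mem_descents tn ltnn.
apply/seteqP; split => [_ [H /(VHC_laminar _ _ up) lH <-]|_ [cs ct <-]].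
  have [vs sc _] := laminar_scan up lH (size p) 0.
  rewrite open_hooks0 in vs sc; rewrite add0n (open_hooks_size lH) in sc.
  have [||||O [ds [es [eO pc cds es_O _]]]] :=
    @scan_colorings p t [::] [seq northeast H i | i <- iota 0 (size p)] wt tp.
  - by rewrite t0 size_map size_iota.
  - by rewrite t0.
  - by rewrite t0.
  - by [].
  rewrite (qE H lH); exists ds => //; apply: color_vector_perm.
  have eO0 : O = [::].
    by move: eO; rewrite t0 sc cats0 /push; case: ifP; case: (O).
  move: pc es_O; rewrite t0 eO0 => pc /size0nil es0.
  by rewrite es0 cats0 perm_sym in pc.
have [bs [sz vs sc pc]] := colorings_scan up wt tp ct.
rewrite t0 push0 tn add0n in sz vs sc pc.
have [H lH eH] := scan_laminar up (esym sz) vs sc.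
exists H; first exact/VHC_laminar.
by rewrite (qE H lH) -eH; apply: color_vector_perm.
Qed.

End Fertilitope.

(** * Reading off the labels *)

Lemma ylabel_vertices (p : seq nat) (t : ptree) :
    That p = hat_tree t -> size (leaves t) = (ndes p).+1 ->
  forall v, v \in vertices (ndes p).+1 0 (hat_tree t) -> ylabel v.1 = v.2.
Proof.
move=> eT sz v vV; rewrite /ylabel eT.
have := vertices_uniq (m := (ndes p).+1) (o := 0) (t := t).
rewrite add0n sz leqnn => /(_ isT).
elim: (vertices _ _ _) vV => //= w s IH;
  rewrite inE => /orP[/eqP <-|vs] /andP[ws us].
  by rewrite eqxx.
case: eqP => [e|_]; last exact: IH.
by move: ws; rewrite e map_f.
Qed.

Import GRing.Theory.
Local Open Scope classical_set_scope.
Local Open Scope ring_scope.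

Theorem theorem4p5 (R : realType) (p : seq nat) (hp : sorted_perm p) :
  Fer R p =
  \big[@msum R (ndes p).+1/[set 0]]_(I in building_set p)
    dilate (ylabel I)%:R (Delta R I).
Proof.
have up : uniq p by case: hp => /and3P[].
have [t [wt t0 tn]] := sorted_canonical_tree hp.
have eL : leaves t = 0%N :: [seq d.+1 | d <- descents p].
  by rewrite (leavesE wt) t0 /ptree_descents t0 subn0 /descents -tn.
have sz : size (leaves t) = (ndes p).+1 by rewrite eL /= size_map.
have uL : uniq (leaves t).
  rewrite eL /= map_inj_uniq ?descents_uniq ?andbT; last exact: succn_inj.
  by apply/mapP => -[].
rewrite /Fer (Vset_colorings R up wt t0 tn) (conv_color_vector (o :=
  0) R uL sz) ?sz //.
rewrite -vertices_msum ?sz //.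
have eT : That p = hat_tree t.
  by rewrite /That (Theta_canonical up wt t0 tn) hat_btree_of.
have yv := ylabel_vertices eT sz.
set V := vertices _ _ _ in yv *.
have uV : uniq [seq v.1 | v <- V] by apply: vertices_uniq; rewrite sz.
transitivity (\big[@msum R (ndes p).+1/[set 0]]_(I <- [seq v.1 | v <- V])
    dilate (ylabel I)%:R (Delta R I)).
  by rewrite big_map [LHS]big_seq [RHS]big_seq; apply: eq_bigr => v /yv ->.
(* Both sums now run over all subsets: a vertex of label 0 contributes the neutral set, and a subset
   that is no vertex has label 0 through the default of [head]. *)
rewrite big_uniq //= big_mkcond [RHS]big_mkcond /=; apply: eq_bigr => I _.
rewrite inE; case: ifPn => [IV|nIV].
  case: posnP => // ->; rewrite dilate0 //; apply: Delta_neq0.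
  by have [] := vertices_block (m := (ndes p).+1) (o := 0) (t := t) _ IV;
    rewrite ?sz.
suff -> : ylabel I = 0%N by [].
rewrite /ylabel eT -/V (_ : filter _ V = [::]) //.
apply/eqP; rewrite -size_eq0 size_filter -leqn0 leqNgt -has_count.
by apply/hasP => -[v vV /eqP e]; move: nIV; rewrite -e map_f.
Qed.
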